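(* Let $s\ge 1$ and fix an explicit Runge-Kutta integrator $\Phi_h$ of order $s$ with $S$ stages. There is a constant $c(s)>0$, determined by the order $s$ (and the chosen integrator), such that the following holds for every $d\ge 1$, all constants $\mu,L>0$, and every $f:\mathbb{R}^d\to\mathbb{R}$ that has a unique minimizer $x^*$, is quasi-strongly convex with constant $\mu$, i.e. $$f(x^* )\ge f(x)+\langle\nabla f(x),x^*-x\rangle+\tfrac{\mu}{2}\|x-x^*\|^2\quad\text{for all }x\in\mathbb{R}^d,$$ and whose derivatives up to order $s+1$ exist and satisfy $\|\nabla^{(n)}f(x)\|\le L$ for all $x\in\mathbb{R}^d$ and $n=2,\dots,s+1$. Let $Q=L/\mu$, $\gamma=\frac{s+3}{2(s+1)}$, let $y_0\in\mathbb{R}^{2d}$ be the initial state, and let $y_{k+1}=\Phi_h(y_k)$ for $k\ge 0$, where $\Phi_h$ is applied to the system $\dot y=F(y)$ with $$F\left(\begin{bmatrix}w \\ x\end{bmatrix}\right)=\begin{bmatrix}-2w-\frac{\nabla f(x)}{\mu\sqrt Q} \\ \sqrt Q\,w\end{bmatrix}.$$ If the step size satisfies $$0<h\le\min\{\mathcal{E}(y_0)^{-\gamma},\,Q^{-\gamma}\}\,\frac{1}{2c(s)^{\frac{1}{s+1}}},$$ then for every $N\ge 0$, $$\mathcal{E}(y_N)\le(1-h/4)^N\,\mathcal{E}(y_0).$$ In particular, writing $y_N=[w_N;x_N]$ and taking $h$ equal to the upper bound above, for every $0<\epsilon\le\mu\mathcal{E}(y_0)/2$ the number of gradient evaluations sufficient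 to obtain $f(x_N)-f(x^* )\le\epsilon$ is $$O\!\left(S\max\{\mathcal{E}(y_0),Q\}^{\gamma}\log\frac{\mu\,\mathcal{E}(y_0)}{\epsilon}\right),$$ where the constant in $O(\cdot)$ depends only on $s$ and the integrator.
   Context: Norms: $\|\cdot\|$ is the Euclidean norm on vectors; for an $n$-th order tensor (multilinear form) $M$, $\|M\|=\max\{M[u_1,\dots,u_n]:\|u_i\|_2=1\}$. Lyapunov function: for $y=[w;x]\in\mathbb{R}^{2d}$ with $w,x\in\mathbb{R}^d$, $$\mathcal{E}(y)=\frac{2(f(x)-f(x^* ))}{\mu}+\frac Q2\|w\|^2+\frac12\|x+\sqrt Q\,w-x^*\|^2.$$ Explicit Runge-Kutta method with $S$ stages: given $\dot y=F(y)$, current point $y$, step size $h$ and fixed real coefficients $a_{ij}$, $b_i$ (independent of $F$), set $g_i=y+h\sum_{j=1}^{i-1}a_{ij}F(g_j)$ for $i=1,\dots,S$ and $\Phi_h(y)=y+h\sum_{i=1}^S b_iF(g_i)$. It has order $s$ if, for sufficiently smooth $F$, $\|\Phi_h(y)-\varphi_h(y)\|=O(h^{s+1})$ as $h\to0$, where $\varphi_h(y)$ denotes the exact solution at time $h$ of $\dot y=F(y)$ started at $y$. Each step uses $S$ gradient evaluations of $f$. If $\mathcal{E}(y_0)=0$, interpret $\mathcal{E}(y_0)^{-\gamma}=+\infty$. *)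

(* Defs.v *)
From HB Require Import structures.
From mathcomp Require Import all_boot all_order all_algebra.
From mathcomp Require Import all_classical all_reals all_analysis.

Set Implicit Arguments.
Unset Strict Implicit.
Unset Printing Implicit Defensive.

Import Order.TTheory GRing.Theory Num.Theory.
Import numFieldNormedType.Exports.

Local Open Scope classical_set_scope.
Local Open Scope ring_scope.

Section euclidean.
Variables (R : realType) (d : nat).
Implicit Types u v : 'rV[R]_d.

Definition inner u v : R := \sum_(i < d) u 0 i * v 0 i.

(* The library's norm on 'rV[R]_d is the sup norm. *)
Definition enorm u : R := Num.sqrt (inner u u).

Definition grad (f : 'rV[R]_d -> R) (x : 'rV[R]_d) : 'rV[R]_d :=
  \row_i 'D_(delta_mx 0 i) f x.

End euclidean.

Section higher_derivatives.
Variables (R : realType) (V W : normedModType R).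

(* iter_derive f [:: u1; ...; un] x = D_u1 (... (D_un f)) x; if f is n times
   Frechet differentiable, this is the value of the n-linear form D^n f(x) at
   (u1, ..., un). *)
Definition iter_derive (f : V -> W) (us : seq V) : V -> W :=
  foldr (fun u g => 'D_u g) f us.

(* In finite dimension, f is n times Frechet differentiable everywhere iff each
   of its iterated derivatives of order < n along constant directions is Frechet
   differentiable everywhere. *)
Definition times_differentiable (n : nat) (f : V -> W) : Prop :=
  forall us : seq V, (size us < n)%N -> forall x, differentiable (iter_derive f us) x.

Definition smooth (f : V -> W) : Prop := forall n, times_differentiable n f.

End higher_derivatives.

Definition nabla (R : realType) (d n : nat) (f : 'rV[R]_d -> R) (x : 'rV[R]_d)
  : n.-tuple 'rV[R]_d -> R := fun us => iter_derive f us x.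
Arguments nabla {R d} n f x.

(* The supremum is taken in \bar R because sup is 0 on unbounded sets; for a
   multilinear form and 0 < d it is finite and attained. *)
Definition tensor_norm (R : realType) (d n : nat)
    (M : n.-tuple 'rV[R]_d -> R) : \bar R :=
  ereal_sup [set (M us)%:E |
             us in [set us : n.-tuple 'rV[R]_d | forall i, enorm (tnth us i) = 1]].

Section runge_kutta.
Variables (R : realType) (S : nat) (a : 'M[R]_S) (b : 'rV[R]_S).

Section step.
Variables (V : lmodType R) (F : V -> V) (h : R) (y : V).

Definition rk_update (g : 'I_S -> V) : 'I_S -> V :=
  fun i => y + h *: \sum_(j < S | (j < i)%N) a i j *: F (g j).

(* Stage i of rk_update only involves the stages j < i, so S iterations compute
   all the stages, whatever the starting family; see rk_stageE. *)
Definition rk_stage : 'I_S -> V := iter S rk_update (fun=> y).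

Definition rk_step : V := y + h *: \sum_(i < S) b 0 i *: F (rk_stage i).

Lemma rk_stageE i :
  rk_stage i = y + h *: \sum_(j < S | (j < i)%N) a i j *: F (rk_stage j).
Proof.
have stable k (j : 'I_S) : (j < k)%N ->
    iter k.+1 rk_update (fun=> y) j = iter k rk_update (fun=> y) j.
  elim: k j => [//|k IHk] j ltjk.
  change (rk_update (iter k.+1 rk_update (fun=> y)) j
          = rk_update (iter k rk_update (fun=> y)) j).
  congr (_ + _ *: _); apply: eq_bigr => l ltlj; congr (_ *: F _).
  by apply: IHk; apply: leq_trans ltlj _.
by rewrite -[LHS]stable.
Qed.

End step.

(* phi is a solution near time 0 of phi' = F(phi), phi(0) = y. *)
Definition local_flow m (F : 'rV[R]_m -> 'rV[R]_m) (y : 'rV[R]_m)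
    (phi : R -> 'rV[R]_m) : Prop :=
  phi 0 = y /\ \forall t \near (0 : R), is_derive (t : R) (1 : R) phi (F (phi t)).

Definition rk_has_order (s : nat) : Prop :=
  forall (m : nat) (F : 'rV[R]_m -> 'rV[R]_m) (y : 'rV[R]_m) (phi : R -> 'rV[R]_m),
    smooth F -> local_flow F y phi ->
    exists C : R,
      \forall h \near 0^'+, enorm (rk_step F h y - phi h) <= C * h ^+ s.+1.

Fixpoint rk_iter (V : lmodType R) (F : V -> V) (h : R) (y0 : V) (k : nat) : V :=
  if k is k'.+1 then rk_step F h (rk_iter F h y0 k') else y0.

End runge_kutta.

Section accelerated_flow.
Variables (R : realType) (d : nat) (mu Q : R) (f : 'rV[R]_d -> R).

Definition unique_minimizer (xs : 'rV[R]_d) : Prop :=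
  (forall x, f xs <= f x) /\ (forall z, (forall x, f z <= f x) -> z = xs).

Definition quasi_strongly_convex (xs : 'rV[R]_d) : Prop :=
  forall x, f xs >= f x + inner (grad f x) (xs - x) + mu / 2 * enorm (x - xs) ^+ 2.

(* A state is y = row_mx w x, with w = lsubmx y and x = rsubmx y. *)
Definition vfield (y : 'rV[R]_(d + d)) : 'rV[R]_(d + d) :=
  row_mx (- (2 *: lsubmx y) - (mu * Num.sqrt Q)^-1 *: grad f (rsubmx y))
         (Num.sqrt Q *: lsubmx y).

Definition lyapunov (xs : 'rV[R]_d) (y : 'rV[R]_(d + d)) : R :=
  2 * (f (rsubmx y) - f xs) / mu + Q / 2 * enorm (lsubmx y) ^+ 2
  + 1 / 2 * enorm (rsubmx y + Num.sqrt Q *: lsubmx y - xs) ^+ 2.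

End accelerated_flow.

Definition rate_exponent (R : realType) (s : nat) : R := (s + 3)%:R / (2 * (s + 1)%:R).
Arguments rate_exponent {R} s.

(* E ^ (- gamma) is read as +oo when E = 0, whereas the library's powR gives 0. *)
Definition step_bound (R : realType) (s : nat) (c E Q : R) : R :=
  (if E == 0 then Q `^ (- rate_exponent s)
   else Num.min (E `^ (- rate_exponent s)) (Q `^ (- rate_exponent s)))
  * (1 / (2 * c `^ (1 / (s + 1)%:R))).

(* Main.v *)
Require Import Defs.
From mathcomp Require Import all_boot all_order all_algebra.
From mathcomp Require Import all_classical all_reals all_analysis.
From mathcomp Require Import ring lra.

Set Implicit Arguments.
Unset Strict Implicit.
Unset Printing Implicit Defensive.

Import Order.TTheory GRing.Theory Num.Theory.
Import numFieldNormedType.Exports.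

Local Open Scope classical_set_scope.
Local Open Scope ring_scope.

(** Along the flow the Lyapunov function [E] decays at rate 1/2, and one step of a method
    of order [s] stays within O(h^(s+1)) of the flow. The whole difficulty is the constant
    in that error: it must not depend on the dimension or on the objective, and it must
    come with the right power of max(E, Q).

    Uniformity. A vector field near a point is abstracted into its Taylor data, normalised
    so that all derivatives up to order [s] are bounded by 1 in some seminorm (record
    [jet]). [uniform_local_error] gives one error constant for all such models. The order
    hypothesis only concerns smooth fields, and its constant may vary with the field, so it
    is used qualitatively. Let P be the Taylor polynomial of the field. Picard iteration
    yields a curve q, polynomial in time, with q' = P(q) + O(t^s). The field
    (tau, u) |-> (1, P(u) + q'(tau) - P(q(tau))) in one more dimension is polynomial, hence
    smooth, and (t, q(t)) is its exact solution. A Runge-Kutta step for a polynomial field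
    is a polynomial in the step size, and the order hypothesis says that its difference with q(h) has no term
    of degree at most [s], whatever the constant was. The remaining coefficients are
    multilinear expressions in the Taylor data, so they are bounded uniformly; this is the
    bookkeeping done by [unif_poly]. Going back from P to the actual field perturbs the
    stages by O(h^(s+1)).

    Scaling. At a point of energy E the field has norm at most 9 sqrt(E) and its derivatives
    are bounded by 6 sqrt(Q). Measuring space in units of sigma = min(sqrt(E/Q), 1) and
    time in units of 1/M, where M = 9 sqrt(max(E, Q)), it becomes a normalised Taylor model
    ([vfield_jet]). Since to first order the energy varies by at most a constant
    times sqrt(Q E) per unit length, and sqrt(Q) sigma <= sqrt(E), the error of one step on
    the energy is at most a constant times E (M h)^(s+1). Compared with the gain h E this
    requires M (M h)^s to be small, and the exponent gamma is large enough for that: with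
    Lam = max(E, Q) and h <= kappa Lam^(-gamma), the power of Lam in M (M h)^s is (s+1)/2 - s gamma <= 0, while
    Lam >= 1/4 ([condition_ge]).

    Decrease. Quasi-strong convexity gives dE(F) <= - E/2 ([dlyapunov_vfield]). The mean
    value theorem along q and the error bound then give the factor 1 - h/4 for one step
    ([lyapunov_step]). The energy does not increase, so the same step size remains
    admissible for all iterates, and the number of iterations follows from
    1 - h/4 <= exp(-h/4). *)

(** * The Euclidean norm *)

Section euclidean_norm.
Variables (R : realType) (d : nat).
Implicit Types (u v w : 'rV[R]_d) (a : R).

Lemma innerC u v : inner u v = inner v u.
Proof. by apply: eq_bigr => i _; rewrite mulrC. Qed.

Lemma innerDl u v w : inner (u + v) w = inner u w + inner v w.
Proof. by rewrite -big_split; apply: eq_bigr => i _; rewrite mxE mulrDl. Qed.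

Lemma innerZl a u v : inner (a *: u) v = a * inner u v.
Proof. by rewrite mulr_sumr; apply: eq_bigr => i _; rewrite mxE mulrA. Qed.

Lemma innerDr u v w : inner u (v + w) = inner u v + inner u w.
Proof. by rewrite !(innerC u) innerDl. Qed.

Lemma innerZr a u v : inner u (a *: v) = a * inner u v.
Proof. by rewrite !(innerC u) innerZl. Qed.

Lemma innerNl u v : inner (- u) v = - inner u v.
Proof. by rewrite -scaleN1r innerZl mulN1r. Qed.

Lemma innerNr u v : inner u (- v) = - inner u v.
Proof. by rewrite !(innerC u) innerNl. Qed.

Lemma inner_ge0 u : 0 <= inner u u.
Proof. by apply: sumr_ge0 => i _; rewrite -expr2 sqr_ge0. Qed.

Lemma enorm_ge0 u : 0 <= enorm u.
Proof. exact: sqrtr_ge0. Qed.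

Lemma sqr_enorm u : enorm u ^+ 2 = inner u u.
Proof. by rewrite sqr_sqrtr ?inner_ge0. Qed.

Lemma enorm_eq0 u : enorm u = 0 -> u = 0.
Proof.
move=> u0; apply/rowP => i; rewrite mxE; apply/eqP.
have : inner u u = 0 by rewrite -sqr_enorm u0 expr0n.
rewrite /inner => /eqP; rewrite psumr_eq0; last by move=> j _; rewrite -expr2 sqr_ge0.
by move=> /allP /(_ i); rewrite mem_index_enum => /(_ isT) /=; rewrite mulf_eq0 orbb.
Qed.

Lemma enorm0 : enorm (0 : 'rV[R]_d) = 0.
Proof. by rewrite /enorm -(scale0r 0) innerZl mul0r sqrtr0. Qed.

Lemma enormZ a u : enorm (a *: u) = `|a| * enorm u.
Proof.
rewrite /enorm innerZl innerZr mulrA -expr2 sqrtrM ?sqr_ge0 //.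
by rewrite sqrtr_sqr.
Qed.

Lemma inner_le u v : inner u v <= enorm u * enorm v.
Proof.
have [v0|v0] := eqVneq (enorm v) 0.
  by rewrite v0 mulr0 (enorm_eq0 v0) -(scale0r 0) innerZr mul0r.
have v1 : 0 < enorm v by rewrite lt_neqAle eq_sym v0 enorm_ge0.
have := inner_ge0 (enorm v *: u - enorm u *: v).
rewrite !(innerDl, innerDr, innerNl, innerNr, innerZl, innerZr) (innerC v u).
rewrite -!sqr_enorm => H.
have [u0|u0] := eqVneq (enorm u) 0.
  by rewrite u0 mul0r (enorm_eq0 u0) -(scale0r 0) innerZl mul0r.
have u1 : 0 < enorm u by rewrite lt_neqAle eq_sym u0 enorm_ge0.
rewrite -(ler_pM2l (mulr_gt0 u1 v1)); nra.
Qed.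

Lemma enormD u v : enorm (u + v) <= enorm u + enorm v.
Proof.
rewrite -(@ler_pXn2r _ 2) ?nnegrE ?addr_ge0 ?enorm_ge0 //.
rewrite sqrrD !sqr_enorm innerDl !innerDr (innerC v u).
by have := inner_le u v; lra.
Qed.

Lemma enormN u : enorm (- u) = enorm u.
Proof. by rewrite -scaleN1r enormZ normrN1 mul1r. Qed.

(** Duality: the norm of [u] is attained by pairing [u] with itself. *)
Lemma enorm_le_dual u (C : R) :
  0 <= C -> (forall v, inner u v <= C * enorm v) -> enorm u <= C.
Proof.
move=> C0 H; have [->//|u0] := eqVneq (enorm u) 0.
have u1 : 0 < enorm u by rewrite lt_neqAle eq_sym u0 enorm_ge0.
by rewrite -(ler_pM2r u1) -expr2 sqr_enorm.
Qed.

End euclidean_norm.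

Lemma enorm_sum (R : realType) (m : nat) (I : Type) (r : seq I) (P : pred I) (F : I -> 'rV[R]_m) :
  enorm (\sum_(i <- r | P i) F i) <= \sum_(i <- r | P i) enorm (F i).
Proof.
elim/big_ind2: _ => [|u1 x1 u2 x2 H1 H2|//]; first by rewrite enorm0.
by rewrite (le_trans (enormD _ _)) // lerD.
Qed.

(** * Taylor models and uniformly bounded polynomial curves *)

(** A vector field near the origin, through its Taylor data: [jform us] stands for the
    derivative of order [size us] at 0 applied to [us], divided by the factorial of the
    order. The derivatives are bounded by 1 in the seminorm, so that constants that
    hold for all jets are uniform in the dimension and in the field. *)
Record jet (R : realType) (s : nat) := Jet {
  jdim : nat;
  jnorm : 'rV[R]_jdim -> R;
  jform : seq 'rV[R]_jdim -> 'rV[R]_jdim;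
  jfield : 'rV[R]_jdim -> 'rV[R]_jdim;
  jnormD : forall u v, jnorm (u + v) <= jnorm u + jnorm v;
  jnormZ : forall (c : R) u, jnorm (c *: u) = `|c| * jnorm u;
  jform_linear : forall us vs (c : R) u v,
    jform (us ++ (c *: u + v) :: vs) =
      c *: jform (us ++ u :: vs) + jform (us ++ v :: vs);
  jform_le : forall us, jnorm (jform us) <= \prod_(u <- us) jnorm u;
  jfield_taylor : forall u,
    jnorm (jfield u - \sum_(k < s) jform (nseq k u)) <= jnorm u ^+ s }.

Section jet_theory.
Variables (R : realType) (s : nat) (J : jet R s).
Implicit Types (u v : 'rV[R]_(jdim J)) (us vs : seq 'rV[R]_(jdim J)).

Definition taylor u : 'rV[R]_(jdim J) := \sum_(k < s) jform (nseq k u).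

Lemma jnorm0 : jnorm (0 : 'rV[R]_(jdim J)) = 0.
Proof. by rewrite -(scale0r 0) jnormZ normr0 mul0r. Qed.

Lemma jnormN u : jnorm (- u) = jnorm u.
Proof. by rewrite -scaleN1r jnormZ normrN1 mul1r. Qed.

Lemma jnorm_ge0 u : 0 <= jnorm u.
Proof.
have := jnormD u (- u); rewrite subrr jnorm0 jnormN -mulr2n pmulrn_lge0 //.
Qed.

Lemma jnorm_sum (I : Type) (r : seq I) (P : pred I) (F : I -> 'rV[R]_(jdim J)) :
  jnorm (\sum_(i <- r | P i) F i) <= \sum_(i <- r | P i) jnorm (F i).
Proof.
elim/big_ind2: _ => [|u1 x1 u2 x2 H1 H2|//]; first by rewrite jnorm0.
by rewrite (le_trans (jnormD _ _)) // lerD.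
Qed.

Lemma jform0 us vs : jform (us ++ 0 :: vs) = 0.
Proof.
have := jform_linear us vs (-1) 0 0.
by rewrite scaler0 addr0 scaleN1r addNr.
Qed.

Lemma jformD us vs u v :
  jform (us ++ (u + v) :: vs) = jform (us ++ u :: vs) + jform (us ++ v :: vs).
Proof. by rewrite -[in LHS](scale1r u) jform_linear scale1r. Qed.

Lemma jformZ us vs (c : R) u :
  jform (us ++ (c *: u) :: vs) = c *: jform (us ++ u :: vs).
Proof. by rewrite -[in LHS](addr0 (c *: u)) jform_linear jform0 addr0. Qed.

Lemma jformN us vs u : jform (us ++ (- u) :: vs) = - jform (us ++ u :: vs).
Proof. by rewrite -scaleN1r jformZ scaleN1r. Qed.

Lemma jform_sum (I : Type) (r : seq I) (F : I -> 'rV[R]_(jdim J)) us vs :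
  jform (us ++ (\sum_(i <- r) F i) :: vs) =
  \sum_(i <- r) jform (us ++ F i :: vs).
Proof.
elim: r => [|i r IH]; first by rewrite !big_nil jform0.
by rewrite !big_cons jformD IH.
Qed.

(** Telescoping, one argument at a time. *)
Lemma jform_nseqB k u v :
  jform (nseq k u) - jform (nseq k v) =
  \sum_(j < k) jform (nseq j u ++ (u - v) :: nseq (k - j.+1) v).
Proof.
pose T j := jform (nseq j u ++ nseq (k - j) v).
have -> : jform (nseq k u) = T k by rewrite /T subnn cats0.
have -> : jform (nseq k v) = T 0 by rewrite /T subn0.
rewrite -(telescope_sumr _ (leq0n k)) big_mkord; apply: eq_bigr => j _.
rewrite jformD jformN /T; congr (jform _ - jform _).
  have -> : nseq j.+1 u = nseq j u ++ [:: u] by rewrite -(nseqD j 1) addn1.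
  by rewrite -catA.
by rewrite -subnSK.
Qed.

Lemma jform_nseq_le k u : jnorm (jform (nseq k u)) <= jnorm u ^+ k.
Proof.
by rewrite (le_trans (jform_le _)) // big_nseq -Monoid.iteropE.
Qed.

Lemma taylor_le u (B : R) : jnorm u <= B -> 1 <= B ->
  jnorm (taylor u) <= s%:R * B ^+ s.
Proof.
move=> uB B1; rewrite (le_trans (jnorm_sum _ _ _)) //.
apply: (@le_trans _ _ (\sum_(k < s) B ^+ s)); last first.
  by rewrite sumr_const card_ord [leRHS]mulr_natl.
apply: ler_sum => k _; rewrite (le_trans (jform_nseq_le _ _)) //.
apply: (@le_trans _ _ (B ^+ k)).
  by rewrite lerXn2r ?nnegrE ?jnorm_ge0 // (le_trans ler01).
by rewrite ler_weXn2l // ltnW.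
Qed.

Lemma taylor_lipschitz u v (B : R) : jnorm u <= B -> jnorm v <= B -> 1 <= B ->
  jnorm (taylor u - taylor v) <= s%:R * (s%:R * B ^+ s) * jnorm (u - v).
Proof.
move=> uB vB B1.
have B0 : 0 <= B by rewrite (le_trans ler01).
rewrite -sumrB (le_trans (jnorm_sum _ _ _)) // -mulrA.
apply: (@le_trans _ _ (\sum_(k < s) s%:R * B ^+ s * jnorm (u - v))); last first.
  by rewrite sumr_const card_ord [leRHS]mulr_natl.
apply: ler_sum => k _; rewrite jform_nseqB (le_trans (jnorm_sum _ _ _)) //.
apply: (@le_trans _ _ (\sum_(j < k) B ^+ s * jnorm (u - v))).
  apply: ler_sum => j _; rewrite (le_trans (jform_le _)) //.
  rewrite big_cat big_cons !big_nseq -!Monoid.iteropE /=.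
  rewrite mulrCA mulrC ler_wpM2r ?jnorm_ge0 //.
  apply: (@le_trans _ _ (B ^+ j * B ^+ (k - j.+1))).
    by apply: ler_pM; rewrite ?exprn_ge0 ?jnorm_ge0 // lerXn2r ?nnegrE ?jnorm_ge0.
  rewrite -exprD ler_weXn2l //.
  rewrite (leq_trans _ (ltnW (ltn_ord k))) //.
  by rewrite -ltnS -addnS subnSK // subnKC // ltnW.
rewrite sumr_const card_ord -[leLHS]mulr_natl -mulrA ler_wpM2r ?ler_nat ?(ltnW (ltn_ord k)) //.
by rewrite mulr_ge0 ?exprn_ge0 ?jnorm_ge0.
Qed.

End jet_theory.

Section unif_poly.
Variables (R : realType) (s : nat) (I : Type) (D : I -> jet R s) (W : I -> R).

Definition curves := forall i, R -> 'rV[R]_(jdim (D i)).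
Implicit Types (q : curves) (k n : nat).

(** Families of curves, polynomial in t and divisible by t^k, with a common bound on the
    degree and on the coefficients. The weight [W] is 1 except in the induction on the
    arity of a multilinear form, where it is the product of the norms of the arguments
    already substituted. Working with families makes all constants uniform while they
    remain implicit. *)
Definition unif_poly k q :=
  exists n (C : R) (v : forall i, nat -> 'rV[R]_(jdim (D i))),
    (forall i j, jnorm (v i j) <= C * W i) /\
    (forall i t, q i t = \sum_(j < n) t ^+ (k + j) *: v i j).

Lemma unif_poly_ext k q q' :
  unif_poly k q -> (forall i t, q' i t = q i t) -> unif_poly k q'.
Proof. by move=> [n [C [v [vC qE]]]] e; exists n, C, v; split=> // i t; rewrite e. Qed.

(** Padding with zeros gives two families a common degree. *)
Lemma unif_poly_pad k q : unif_poly k q ->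
  exists n0 (C : R) (v : forall i, nat -> 'rV[R]_(jdim (D i))),
    (forall i j, jnorm (v i j) <= C * W i) /\
    (forall i t n, (n0 <= n)%N -> q i t = \sum_(j < n) t ^+ (k + j) *: v i j).
Proof.
move=> [n0 [C [v [vC qE]]]].
exists n0, C, (fun i j => if (j < n0)%N then v i j else 0); split=> [i j|i t n len].
  by case: ifP => // _; rewrite jnorm0 (le_trans (jnorm_ge0 (v i j))).
rewrite qE (big_ord_widen n (fun j => t ^+ (k + j) *: v i j) len) big_mkcond.
by apply: eq_bigr => j _; case: ifP; rewrite ?scaler0.
Qed.

Lemma unif_polyD k q q' : unif_poly k q -> unif_poly k q' ->
  unif_poly k (fun i t => q i t + q' i t).
Proof.
move=> /unif_poly_pad [n [C [v [vC qE]]]] /unif_poly_pad [n' [C' [v' [vC' qE']]]].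
exists (maxn n n'), (C + C'), (fun i j => v i j + v' i j); split=> [i j|i t].
  by rewrite (le_trans (jnormD _ _)) // mulrDl lerD.
rewrite (qE _ _ _ (leq_maxl n n')) (qE' _ _ _ (leq_maxr n n')) -big_split.
by apply: eq_bigr => j _; rewrite scalerDr.
Qed.

Lemma unif_polyZ k (c : R) q : unif_poly k q -> unif_poly k (fun i t => c *: q i t).
Proof.
move=> [n [C [v [vC qE]]]].
exists n, (`|c| * C), (fun i j => c *: v i j); split=> [i j|i t].
  by rewrite jnormZ -mulrA ler_wpM2l.
by rewrite qE scaler_sumr; apply: eq_bigr => j _; rewrite !scalerA mulrC.
Qed.

Lemma unif_polyN k q : unif_poly k q -> unif_poly k (fun i t => - q i t).
Proof.
by move=> /(unif_polyZ (-1))/unif_poly_ext; apply=> i t; rewrite scaleN1r.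
Qed.

Lemma unif_polyB k q q' : unif_poly k q -> unif_poly k q' ->
  unif_poly k (fun i t => q i t - q' i t).
Proof. by move=> qk /unif_polyN; apply: unif_polyD. Qed.

Lemma unif_polyMX k l q : unif_poly k q ->
  unif_poly (l + k) (fun i t => t ^+ l *: q i t).
Proof.
move=> [n [C [v [vC qE]]]]; exists n, C, v; split=> // i t.
rewrite qE scaler_sumr; apply: eq_bigr => j _.
by rewrite scalerA -exprD addnA.
Qed.

Lemma unif_poly_weak k l q : unif_poly (l + k) q -> unif_poly k q.
Proof.
move=> [n [C [v [vC qE]]]].
exists (l + n)%N, C, (fun i j => if (j < l)%N then 0 else v i (j - l)%N).
split=> [i j|i t].
  by case: ifP => // _; rewrite jnorm0 (le_trans (jnorm_ge0 (v i j))).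
rewrite big_split_ord /= big1 ?add0r => [|j _]; last by rewrite ltn_ord scaler0.
rewrite qE; apply: eq_bigr => j _.
by rewrite ltnNge leq_addr /= addKn addnCA addnA.
Qed.

Lemma unif_poly0 k : unif_poly k (fun i t => 0).
Proof.
exists 0%N, 0, (fun i j => 0); split=> [i j|i t]; first by rewrite jnorm0 mul0r.
by rewrite big_ord0.
Qed.

Lemma unif_poly_sum k (X : Type) (r : seq X) (P : pred X) (q : X -> curves) :
  (forall x, P x -> unif_poly k (q x)) ->
  unif_poly k (fun i t => \sum_(x <- r | P x) q x i t).
Proof.
move=> qk; elim: r => [|x r IH].
  by apply: unif_poly_ext (unif_poly0 k) _ => i t; rewrite big_nil.
case Px: (P x); last by apply: unif_poly_ext IH _ => i t; rewrite big_cons Px.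
by apply: unif_poly_ext (unif_polyD (qk _ Px) IH) _ => i t; rewrite big_cons Px.
Qed.

Lemma unif_poly_dilate k (c : R) q : unif_poly k q ->
  unif_poly k (fun i t => q i (c * t)).
Proof.
move=> [n [C [v [vC qE]]]].
exists n, ((1 + `|c|) ^+ (k + n) * C),
  (fun i j => if (j < n)%N then c ^+ (k + j) *: v i j else 0); split=> [i j|i t].
  have vW : 0 <= C * W i by rewrite (le_trans (jnorm_ge0 (v i j))).
  case: ifP => jn; last by rewrite jnorm0 -mulrA mulr_ge0 ?exprn_ge0 ?addr_ge0.
  rewrite jnormZ -mulrA; apply: ler_pM; rewrite ?jnorm_ge0 //.
  rewrite normrX (@le_trans _ _ ((1 + `|c|) ^+ (k + j))) //.
    by rewrite lerXn2r ?nnegrE ?addr_ge0 // lerDr.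
  by rewrite ler_weXn2l ?lerDl // leq_add2l ltnW.
rewrite qE; apply: eq_bigr => j _; rewrite ltn_ord scalerA exprMn mulrC //.
Qed.

Lemma unif_poly_primitive k q : unif_poly k q ->
  exists q1, unif_poly k.+1 q1 /\
    forall i t, is_derive (t : R) (1 : R) (q1 i) (q i t).
Proof.
move=> [n [C [v [vC qE]]]].
pose w i j := (k + j).+1%:R^-1 *: v i j.
exists (fun i t => \sum_(j < n) t ^+ (k.+1 + j) *: w i j); split.
  exists n, C, w; split=> // i j; rewrite jnormZ (le_trans _ (vC i j)) //.
  by rewrite ler_piMl ?jnorm_ge0 // ger0_norm ?invr_ge0 // invf_le1 // ler1n.
move=> i t; rewrite qE.
have -> : (fun x => \sum_(j < n) x ^+ (k.+1 + j) *: w i j) =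
   \sum_(j < n) (fun x : R => x ^+ (k + j).+1 *: w i j).
  by apply/funext => x; rewrite fct_sumE.
apply: is_derive_sum => j.
have dX : is_derive t (1 : R) (fun x : R => x ^+ (k + j).+1) ((k + j).+1%:R * t ^+ (k + j)).
  apply: DeriveDef; first exact: exprn_derivable.
  by rewrite exp_derive /= /GRing.scale /= mulr1.
have dfX : differentiable (fun x : R => x ^+ (k + j).+1) t.
  by apply/derivable1_diffP; apply: ex_derive.
apply: DeriveDef; first by apply/derivable1_diffP/differentiableZl.
rewrite deriveE; last exact: differentiableZl.
rewrite diffZl // -deriveE // derive_val /w scalerA mulrC mulrA mulVf ?mul1r //.
Qed.

End unif_poly.

(** * Multilinear substitution and Picard iteration *)

Lemma prod_jnorm_ge0 (R : realType) (s : nat) (J : jet R s)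
    (us : seq 'rV[R]_(jdim J)) : 0 <= \prod_(u <- us) jnorm u.
Proof. by apply: prodr_ge0 => u _; apply: jnorm_ge0. Qed.

Section multilinear_closure.
Variables (R : realType) (s : nat).

(** A jet together with frozen leading arguments of its forms. *)
Let prefixed := {J : jet R s & seq 'rV[R]_(jdim J)}.
Let pjet (i : prefixed) : jet R s := projT1 i.
Let pweight (i : prefixed) : R := \prod_(u <- projT2 i) jnorm u.

Local Notation jcurves := (@curves R s (jet R s) id).
Local Notation upoly := (@unif_poly R s (jet R s) id (fun=> 1)).

(** The orders of vanishing at 0 of the arguments add up. *)
Inductive poly_args : nat -> seq (jcurves) -> Prop :=
| poly_args_nil : poly_args 0 [::]
| poly_args_cons k l q qs : upoly k q -> poly_args l qs ->
    poly_args (k + l) (q :: qs).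

(** Substituting polynomial curves into a multilinear form, from left to right: the
    coefficients of the first curve join the frozen arguments, so the induction
    hypothesis is used over the enlarged index. *)
Lemma unif_poly_prefixed_form k (qs : seq (jcurves)) : poly_args k qs ->
  unif_poly (D := pjet) pweight k
    (fun i t => jform (projT2 i ++ [seq q (projT1 i) t | q <- qs])).
Proof.
elim=> [|{}k l q {}qs [n [C [w [wC qE]]]] _ [n' [C' [v [vC' vE]]]]].
  exists 1%N, 1, (fun i j => jform (projT2 i)); split=> [i j|i t].
    by rewrite mul1r; apply: jform_le.
  by rewrite big_ord1 expr0 scale1r cats0.
pose ext (a : nat) (i : prefixed) : prefixed :=
  existT _ (projT1 i) (rcons (projT2 i) (w (projT1 i) a)).
pose q1 (a : nat) : curves pjet := fun i t => \sum_(j < n') t ^+ (l + j) *: v (ext a i) j.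
have q1P a : unif_poly pweight l (q1 a).
  exists n', (`|C'| * C), (fun i => v (ext a i)); split=> // i j.
  apply: (le_trans (vC' (ext a i) j)); rewrite /pweight /= -cats1 big_cat big_seq1 /=.
  rewrite -mulrA; apply: (@le_trans _ _ (`|C'| * (\prod_(u <- projT2 i) jnorm u *
     jnorm (w (projT1 i) a)))).
    by rewrite ler_wpM2r ?ler_norm // mulr_ge0 ?jnorm_ge0 ?prod_jnorm_ge0.
  rewrite ler_wpM2l // mulrC ler_wpM2r ?prod_jnorm_ge0 //.
  by have := wC (projT1 i) a; rewrite mulr1.
have H : unif_poly (D := pjet) pweight (k + l)
    (fun i t => \sum_(a < n) t ^+ (k + a) *: q1 a i t).
  apply: unif_poly_sum => a _.
  apply: (@unif_poly_weak _ _ _ pjet _ _ a).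
  by rewrite addnA (addnC a); apply: unif_polyMX (q1P a).
apply: unif_poly_ext H _ => -[J us] t /=.
rewrite qE jform_sum; apply: eq_bigr => a _.
rewrite jformZ; congr (_ *: _).
by have /= := vE (ext a (existT _ J us)) t; rewrite -cats1 -catA.
Qed.

Lemma unif_poly_form k (qs : seq (jcurves)) : poly_args k qs ->
  upoly k (fun J t => jform [seq q J t | q <- qs]).
Proof.
move=> /unif_poly_prefixed_form [n [C [v [vC vE]]]].
exists n, C, (fun J => v (existT _ J [::])); split=> [J j|J t].
  by have := vC (existT _ J [::]) j; rewrite /pweight /= big_nil.
exact: (vE (existT _ J [::])).
Qed.

Lemma poly_args_cat k l qs qs' : poly_args k qs -> poly_args l qs' ->
  poly_args (k + l) (qs ++ qs').
Proof.
by elim=> [|{}k m q {}qs qk _ IH] // /IH; rewrite -addnA; apply: poly_args_cons.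
Qed.

Lemma poly_args_nseq n q : upoly 0 q -> poly_args 0 (nseq n q).
Proof.
by move=> q0; elim: n => [|n IH]; [apply: poly_args_nil | apply: (poly_args_cons q0 IH)].
Qed.

Lemma unif_poly_taylor q : upoly 0 q ->
  upoly 0 (fun J t => taylor (q J t)).
Proof.
move=> q0; apply: unif_poly_sum => k _.
apply: unif_poly_ext (unif_poly_form (poly_args_nseq k q0)) _ => J t.
by rewrite map_nseq.
Qed.

(** Telescoping puts the difference of the two curves in one argument of each form, so the
    order of vanishing of that difference is inherited. *)
Lemma unif_poly_taylorB k q q' : upoly 0 q -> upoly 0 q' ->
  upoly k (fun J t => q J t - q' J t) ->
  upoly k (fun J t => taylor (q J t) - taylor (q' J t)).
Proof.
move=> q0 q'0 qq'.
have H : upoly k (fun J t => \sum_(i < s) \sum_(j < i)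
    jform (nseq j (q J t) ++ (q J t - q' J t) :: nseq (i - j.+1) (q' J t))).
  apply: unif_poly_sum => i _; apply: unif_poly_sum => j _.
  have A := poly_args_cat (poly_args_nseq j q0)
    (poly_args_cons qq' (poly_args_nseq (i - j.+1) q'0)).
  rewrite addn0 in A; apply: unif_poly_ext (unif_poly_form A) _ => J t.
  by rewrite map_cat /= !map_nseq.
apply: unif_poly_ext H _ => J t; rewrite -sumrB.
by apply: eq_bigr => i _; rewrite jform_nseqB.
Qed.

End multilinear_closure.

Section plain_families.
Variables (R : realType) (s : nat).
Local Notation jcurves := (@curves R s (jet R s) id).
Local Notation upoly := (@unif_poly R s (jet R s) id (fun=> 1)).
Implicit Types q : jcurves.

Lemma unif_poly_le k q (B : R) : upoly k q ->
  exists2 C : R, 0 <= C & forall J t, `|t| <= B -> jnorm (q J t) <= C * `|t| ^+ k.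
Proof.
move=> [n [C [v [vC qE]]]].
exists (\sum_(j < n) `|B| ^+ j * `|C|).
  by apply: sumr_ge0 => j _; rewrite mulr_ge0 ?exprn_ge0.
move=> J t tB; rewrite qE (le_trans (jnorm_sum _ _ _)) // mulr_suml.
apply: ler_sum => j _; rewrite jnormZ normrX exprD -mulrA mulrC ler_wpM2r ?exprn_ge0 //.
apply: ler_pM; rewrite ?exprn_ge0 ?jnorm_ge0 //.
  by rewrite lerXn2r ?nnegrE // (le_trans tB) // ler_norm.
by have := vC J j; rewrite mulr1 => /le_trans; apply; rewrite ler_norm.
Qed.

Lemma unif_poly_at0 k q : upoly k.+1 q -> forall J, q J 0 = 0.
Proof.
move=> [n [C [v [_ qE]]]] J.
by rewrite qE big1 // => j _; rewrite addSn expr0n scale0r.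
Qed.

(** The coefficients are peeled off by increasing degree: once the lower ones vanish,
    dividing by the power of t and letting t tend to 0 isolates the next one. *)
Lemma poly_flat_coef (m n k : nat) (v : nat -> 'rV[R]_m) (C : R) : (k <= n)%N ->
  (\forall t \near 0^'+, enorm (\sum_(j < n) t ^+ j *: v j) <= C * t ^+ k) ->
  forall j, (j < k)%N -> v j = 0.
Proof.
elim: k => [//|k IH] in C *; move=> kn H.
have vk0 j : (j < k)%N -> v j = 0.
  apply: (IH `|C|); first exact: ltnW.
  near=> t.
  have t0 : 0 < t by [].
  have t1 : t <= 1 by near: t; apply: nbhs_right_le.
  apply: (@le_trans _ _ (C * t ^+ k.+1)); first by near: t.
  apply: (@le_trans _ _ (`|C| * t ^+ k.+1)).
    by rewrite ler_wpM2r ?ler_norm // exprn_ge0 // ltW.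
  by rewrite ler_wpM2l // exprS ler_piMl // exprn_ge0 // ltW.
move=> j; rewrite ltnS leq_eqVlt => /predU1P[->|]; last exact: vk0.
apply: enorm_eq0; apply/eqP; rewrite eq_le enorm_ge0 andbT leNgt; apply/negP => vpos.
pose B := \sum_(j < n) enorm (v j).
have B0 : 0 <= B by apply: sumr_ge0 => i _; apply: enorm_ge0.
have [t [t0 t1 tB Ht]] : exists t : R, [/\ 0 < t, t <= 1, t * (`|C| + B + 1) < enorm (v k)
    & enorm (\sum_(j < n) t ^+ j *: v j) <= C * t ^+ k.+1].
  near (0 : R)^'+ => t; exists t; split => //.
  - by near: t; apply: nbhs_right_le.
  - rewrite -ltr_pdivlMr; last by rewrite ltr_wpDl // addr_ge0.
    by near: t; apply: nbhs_right_lt; rewrite divr_gt0 // ltr_wpDl // addr_ge0.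
  - by near: t.
have tk : 0 < t ^+ k by rewrite exprn_gt0.
have tk1 : 0 <= t ^+ k.+1 by rewrite exprn_ge0 // ltW.
move: Ht; rewrite (bigD1 (Ordinal kn)) //=; set S := \sum_(i < n | _) _ => Ht.
have SB : enorm S <= t ^+ k.+1 * B.
  rewrite (le_trans (enorm_sum _ _ _)) // /B mulr_sumr [leRHS](bigID (fun i => i != Ordinal kn)) /=.
  rewrite ler_wpDr //; first by apply: sumr_ge0 => i _; rewrite mulr_ge0 ?enorm_ge0.
  apply: ler_sum => i ik; have [ilt|kle] := ltnP i k.
    by rewrite vk0 // scaler0 enorm0 mulr0.
  rewrite enormZ ler_wpM2r ?enorm_ge0 // ger0_norm ?exprn_ge0 ?(ltW t0) //.
  rewrite ler_wiXn2l ?(ltW t0) // ltn_neqAle kle andbT eq_sym.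
  by apply: contra ik => /eqP e; apply/eqP/val_inj.
have : enorm (t ^+ k *: v k) <= C * t ^+ k.+1 + t ^+ k.+1 * B.
  rewrite -[t ^+ k *: v k](addrK S) (le_trans (enormD _ _)) // enormN.
  by rewrite lerD.
rewrite enormZ ger0_norm ?(ltW tk) // exprSr mulrCA -mulrA -mulrDr ler_pM2l //.
move=> Hle; have := ler_norm C.
have : 0 <= t * (`|C| - C) by rewrite mulr_ge0 ?subr_ge0 ?ler_norm // ltW.
by nra.
Unshelve. all: by end_near. Qed.

(** This turns a qualitative estimate, whose constant depends on the jet, into a uniform
    one: it only serves to show that some coefficients vanish, and the others are
    already bounded. *)
Lemma unif_poly_flat k q : upoly 0 q ->
  (forall J, exists C, \forall t \near 0^'+, enorm (q J t) <= C * t ^+ k) ->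
  upoly k q.
Proof.
move=> /unif_poly_pad [n [C [v [vC qE]]]] qflat.
exists n, C, (fun J j => v J (k + j)%N); split=> [J j|J t]; first exact: vC.
rewrite (qE J t (k + n)%N (leq_addl _ _)) big_split_ord /= big1 ?add0r // => j _.
have [B HB] := qflat J.
rewrite (@poly_flat_coef _ (k + n) k (v J) B) ?scaler0 ?leq_addr //.
by apply: filterS HB => x; rewrite (qE J x (k + n)%N (leq_addl _ _)).
Qed.

(** Picard iteration. Consecutive iterates agree to one order more at each step,
    so after [s] steps the defect of the differential equation is O(t^s). *)
Lemma picard_curve : exists q q1 : jcurves,
  [/\ upoly 1 q, upoly 0 q1,
      forall J t, is_derive (t : R) (1 : R) (q J) (q1 J t) &
      upoly s (fun J t => q1 J t - taylor (q J t))].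
Proof.
suff H k : exists p q : jcurves, [/\ upoly 1 p, upoly 1 q,
    forall J t, is_derive (t : R) (1 : R) (q J) (taylor (p J t))
    & upoly k (fun J t => q J t - p J t)].
  have [p [q [p1 q1 dq pq]]] := H s.
  have p0 := unif_poly_weak (p1 : upoly (1 + 0) p).
  have q0 := unif_poly_weak (q1 : upoly (1 + 0) q).
  exists q, (fun J t => taylor (p J t)); split=> //; first exact: unif_poly_taylor.
  apply: unif_poly_taylorB => //.
  apply: unif_poly_ext (unif_polyN pq) _ => J t.
  by rewrite opprB.
elim: k => [|k [p [q [p1 q1 dq pq]]]].
  have z0 : upoly 0 (fun J t => 0) by apply: unif_poly0.
  have [q [q1 dq]] := unif_poly_primitive (unif_poly_taylor z0).
  exists (fun J t => 0), q; split=> //; first exact: unif_poly0.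
  apply: unif_poly_ext (unif_poly_weak (q1 : upoly (1 + 0) q)) _ => J t.
  by rewrite subr0.
have p0 := unif_poly_weak (p1 : upoly (1 + 0) p).
have q0 := unif_poly_weak (q1 : upoly (1 + 0) q).
have [z [z1 dz]] := unif_poly_primitive (unif_poly_taylorB q0 p0 pq).
exists q, (fun J t => q J t + z J t); split=> //.
- apply: unif_polyD q1 _; apply: (@unif_poly_weak _ _ _ _ _ _ k).
  by rewrite addn1.
- move=> J t; have := is_deriveD (dq J t) (dz J t).
  by rewrite addrCA addrN addr0.
- by apply: unif_poly_ext z1 _ => J t; rewrite addrAC subrr add0r.
Qed.

End plain_families.

(** * Polynomial vector fields and suspension *)

Section polynomial_maps.
Variables (R : realType) (n : nat).

(** Polynomial functions of the coordinates, as an inductive class so that closure under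
    directional derivatives is an induction. *)
Inductive poly_fun : ('rV[R]_n -> R) -> Prop :=
| poly_fun_cst c : poly_fun (fun=> c)
| poly_fun_coord i : poly_fun (fun z => z 0 i)
| poly_funD f g : poly_fun f -> poly_fun g -> poly_fun (fun z => f z + g z)
| poly_funM f g : poly_fun f -> poly_fun g -> poly_fun (fun z => f z * g z).

Definition poly_map m (F : 'rV[R]_n -> 'rV[R]_m) : Prop :=
  forall j, poly_fun (fun z => F z 0 j).

Lemma poly_fun_differentiable f : poly_fun f -> forall x, differentiable f x.
Proof.
elim=> [c|i|{}f g _ df _ dg|{}f g _ df _ dg] x.
- exact: differentiable_cst.
- exact: differentiable_coord.
- exact: differentiableD.
- exact: differentiableM.
Qed.

Lemma poly_fun_derive f u : poly_fun f -> poly_fun ('D_u f).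
Proof.
elim=> [c|i|{}f g pf df pg dg|{}f g pf df pg dg].
- have -> : 'D_u (fun=> c) = (fun=> 0 : R) by apply/funext => x; apply: derive_cst.
  exact: poly_fun_cst.
- have -> : 'D_u (fun z : 'rV[R]_n => z 0 i) = (fun=> u 0 i).
    apply/funext => x; have did := @derivable_id R 'rV[R]_n x u.
    have := derive_mx did; rewrite derive_id => /rowP/(_ i).
    by rewrite mxE.
  exact: poly_fun_cst.
- have -> : 'D_u (fun z => f z + g z) = (fun z => 'D_u f z + 'D_u g z).
    by apply/funext => x; apply: deriveD; apply: diff_derivable;
       apply: poly_fun_differentiable.
  exact: poly_funD.
- have -> : 'D_u (fun z => f z * g z) = (fun z => f z * 'D_u g z + g z * 'D_u f z).
    by apply/funext => x; apply: deriveM; apply: diff_derivable;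
       apply: poly_fun_differentiable.
  by apply: poly_funD; apply: poly_funM.
Qed.

Lemma poly_map_differentiable m (F : 'rV[R]_n -> 'rV[R]_m) :
  poly_map F -> forall x, differentiable F x.
Proof.
move=> pF x.
have -> : F = \sum_(j < m) (fun z => F z 0 j *: delta_mx 0 j).
  by apply/funext => z; rewrite fct_sumE [LHS]row_sum_delta.
by apply: differentiable_sum => j; apply: differentiableZl; apply: poly_fun_differentiable.
Qed.

Lemma poly_map_derive m (F : 'rV[R]_n -> 'rV[R]_m) u :
  poly_map F -> poly_map ('D_u F).
Proof.
move=> pF j; have -> : (fun z => 'D_u F z 0 j) = 'D_u (fun z => F z 0 j).
  apply/funext => x; rewrite derive_mx ?mxE //.
  exact/diff_derivable/poly_map_differentiable.
exact: poly_fun_derive.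
Qed.

Lemma smooth_poly_map m (F : 'rV[R]_n -> 'rV[R]_m) : poly_map F -> smooth F.
Proof.
move=> pF k us _; apply: poly_map_differentiable.
by elim: us => //= u us; apply: poly_map_derive.
Qed.

Lemma poly_map_cst m (w : 'rV[R]_m) : poly_map (fun=> w).
Proof. by move=> j; apply: poly_fun_cst. Qed.

Lemma poly_mapD m (F G : 'rV[R]_n -> 'rV[R]_m) :
  poly_map F -> poly_map G -> poly_map (fun z => F z + G z).
Proof.
move=> pF pG j.
rewrite (_ : (fun z => _) = (fun z => F z 0 j + G z 0 j)); first exact: poly_funD.
by apply/funext => z; rewrite mxE.
Qed.

Lemma poly_map_sum m (I : Type) (r : seq I) (F : I -> 'rV[R]_n -> 'rV[R]_m) :
  (forall i, poly_map (F i)) -> poly_map (fun z => \sum_(i <- r) F i z).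
Proof.
move=> pF; elim: r => [|i r IH].
  rewrite (_ : (fun z => _) = (fun z => 0)); first exact: poly_map_cst.
  by apply/funext => z; rewrite big_nil.
rewrite (_ : (fun z => _) = (fun z => F i z + \sum_(i <- r) F i z)).
  exact: poly_mapD.
by apply/funext => z; rewrite big_cons.
Qed.

Lemma poly_mapZ m (f : 'rV[R]_n -> R) (G : 'rV[R]_n -> 'rV[R]_m) :
  poly_fun f -> poly_map G -> poly_map (fun z => f z *: G z).
Proof.
move=> pf pG j.
rewrite (_ : (fun z => _) = (fun z => f z * G z 0 j)); first exact: poly_funM.
by apply/funext => z; rewrite mxE.
Qed.

Lemma poly_funX f k : poly_fun f -> poly_fun (fun z => f z ^+ k).
Proof.
move=> pf; elim: k => [|k IH]; first exact: poly_fun_cst.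
rewrite (_ : (fun z => _) = (fun z => f z * f z ^+ k)); first exact: poly_funM.
by apply/funext => z; rewrite exprS.
Qed.

End polynomial_maps.

Lemma is_derive_mx (R : realType) m n (M : R -> 'M[R]_(m, n)) (t : R) (dM : 'M[R]_(m, n)) :
  (forall i j, is_derive t (1 : R) (fun x => M x i j) (dM i j)) ->
  is_derive t (1 : R) M dM.
Proof.
move=> H; have dvM : derivable M t 1 by apply/derivable_mxP => i j; apply: ex_derive.
by apply: DeriveDef => //; rewrite derive_mx //; apply/matrixP => i j; rewrite mxE derive_val.
Qed.

Lemma is_derive_entry (R : realType) m n (M : R -> 'M[R]_(m, n)) (t : R) (dM : 'M[R]_(m, n)) i j :
  is_derive t (1 : R) M dM -> is_derive t (1 : R) (fun x => M x i j) (dM i j).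
Proof.
move=> dMt; have dvM : derivable M t 1 by apply: ex_derive.
apply: DeriveDef; first by move/derivable_mxP: dvM.
by rewrite -(@derive_val _ _ _ _ _ _ _ dMt) derive_mx // mxE.
Qed.

Lemma enorm_rsubmx_le (R : realType) m n (z : 'rV[R]_(m + n)) : enorm (rsubmx z) <= enorm z.
Proof.
rewrite ler_sqrt ?inner_ge0 // /inner big_split_ord /= ler_wpDl //.
  by apply: sumr_ge0 => i _; rewrite -expr2 sqr_ge0.
by apply: ler_sum => i _; rewrite !mxE.
Qed.

Lemma lsubmxZ (R : realType) m n (c : R) (z : 'rV[R]_(m + n)) :
  lsubmx (c *: z) = c *: lsubmx z.
Proof. by apply/rowP => i; rewrite !mxE. Qed.

Lemma rsubmxZ (R : realType) m n (c : R) (z : 'rV[R]_(m + n)) :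
  rsubmx (c *: z) = c *: rsubmx z.
Proof. by apply/rowP => i; rewrite !mxE. Qed.

Section suspension.
Variables (R : realType) (s : nat) (J : jet R s) (r : R -> 'rV[R]_(jdim J)).

(** Adding time as a coordinate allows the correction [r], which makes a prescribed
    polynomial curve an exact solution. *)
Definition suspension (z : 'rV[R]_(1 + jdim J)) : 'rV[R]_(1 + jdim J) :=
  row_mx 1 (taylor (rsubmx z) + r (z 0 (lshift (jdim J) 0))).

(** Expanding the first free argument in the canonical basis trades one argument for a
    coordinate factor. *)
Lemma poly_map_jform us k :
  poly_map (fun z : 'rV[R]_(1 + jdim J) => jform (us ++ nseq k (rsubmx z))).
Proof.
elim: k us => [|k IH] us; first exact: (poly_map_cst _ (jform (us ++ [::]))). 
rewrite (_ : (fun z => _) = (fun z : 'rV[R]_(1 + jdim J) => \sum_(i < jdim J) z 0 (rshift 1 i) *: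
    jform (rcons us (delta_mx 0 i) ++ nseq k (rsubmx z)))).
  by apply: poly_map_sum => i; apply: poly_mapZ (IH _); apply: poly_fun_coord.
apply/funext => z /=; rewrite [in LHS](_ : us ++ _ =
    us ++ (\sum_(i < jdim J) z 0 (rshift 1 i) *: delta_mx 0 i) :: nseq k (rsubmx z)).
  by rewrite jform_sum; apply: eq_bigr => i _; rewrite jformZ -cats1 -catA.
by congr (_ ++ _ :: _); rewrite [LHS]row_sum_delta; apply: eq_bigr => i _; rewrite mxE.
Qed.

Lemma smooth_suspension (n : nat) (v : nat -> 'rV[R]_(jdim J)) (k : nat -> nat) :
  (forall t, r t = \sum_(j < n) t ^+ (k j) *: v j) -> smooth suspension.
Proof.
move=> rE; apply: smooth_poly_map => j; rewrite /suspension.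
case: (splitP j) => i ij.
  have -> : j = lshift _ i by apply: val_inj.
  rewrite (_ : (fun z => _) = (fun z => (1 : 'rV[R]_1) 0 i)); first exact: poly_fun_cst.
  by apply/funext => z; rewrite row_mxEl.
have -> : j = rshift 1 i by apply: val_inj.
rewrite (_ : (fun z => _) = (fun z : 'rV[R]_(1 + jdim J) =>
    (taylor (rsubmx z) + r (z 0 (lshift (jdim J) 0))) 0 i)); last first.
  by apply/funext => z; rewrite row_mxEr.
move: i {ij}; apply: poly_mapD; first by apply: poly_map_sum => i; apply: (poly_map_jform [::]).
rewrite (_ : (fun z => _) = (fun z : 'rV[R]_(1 + jdim J) =>
    \sum_(j < n) z 0 (lshift (jdim J) 0) ^+ k j *: v j)); last by apply/funext.
apply: poly_map_sum => i; apply: poly_mapZ; last exact: poly_map_cst.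
by apply: poly_funX; apply: poly_fun_coord.
Qed.

(** With the defect of [q] as correction, the graph of [q] solves the equation exactly. *)
Lemma suspension_flow (q q1 : R -> 'rV[R]_(jdim J)) :
  q 0 = 0 -> (forall t, is_derive (t : R) (1 : R) q (q1 t)) ->
  (forall t, r t = q1 t - taylor (q t)) ->
  local_flow suspension 0 (fun t => row_mx t%:M (q t)).
Proof.
move=> q0 dq rE; split; first by rewrite q0 raddf0 row_mx0.
near=> t; apply: is_derive_mx => i j; rewrite /suspension.
case: (splitP j) => j' jj'.
  have -> : j = lshift _ j' by apply: val_inj.
  rewrite (_ : (fun x => _) = id); last first.
    by apply/funext => x; rewrite row_mxEl mxE !ord1.
  rewrite row_mxEl mxE !ord1; exact: is_derive_id.
have -> : j = rshift 1 j' by apply: val_inj.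
rewrite (_ : (fun x => _) = (fun x => q x i j')); last first.
  by apply/funext => x; rewrite row_mxEr.
rewrite !row_mxEr row_mxKr row_mxEl (_ : (t%:M : 'M[R]_1) 0 0 = t); last by rewrite mxE.
rewrite rE addrC subrK.
exact: is_derive_entry.
Unshelve. all: by end_near. Qed.

Section rk.
Variables (S : nat) (a : 'M[R]_S) (b : 'rV[R]_S).

(** The times at which the stages sample the correction, in units of the step size. *)
Definition abscissa (i : 'I_S) : R := \sum_(j < S | (j < i)%N) a i j.

Local Notation Z h := (rk_stage a suspension h 0).

Lemma suspension_stage_time h i : Z h i 0 (lshift (jdim J) 0) = h * abscissa i.
Proof.
rewrite rk_stageE add0r mxE summxE; congr (_ * _); apply: eq_bigr => j _.
by rewrite mxE row_mxEl mxE mulr1.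
Qed.

Lemma suspension_stage h i : rsubmx (Z h i) =
  h *: \sum_(j < S | (j < i)%N) a i j *: (taylor (rsubmx (Z h j)) + r (abscissa j * h)).
Proof.
rewrite rk_stageE add0r rsubmxZ raddf_sum; congr (_ *: _).
apply: eq_bigr => j _; rewrite /= rsubmxZ /suspension row_mxKr.
by rewrite suspension_stage_time mulrC.
Qed.

Lemma suspension_step h : rsubmx (rk_step a b suspension h 0) =
  h *: \sum_(j < S) b 0 j *: (taylor (rsubmx (Z h j)) + r (abscissa j * h)).
Proof.
rewrite /rk_step add0r rsubmxZ raddf_sum; congr (_ *: _).
apply: eq_bigr => j _; rewrite /= rsubmxZ /suspension row_mxKr.
by rewrite suspension_stage_time mulrC.
Qed.

End rk.

End suspension.

(** * The local error of the integrator, uniformly over Taylor models *)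

Section bigO.
Variables (R : realType) (s : nat).
Local Notation jcurves := (@curves R s (jet R s) id).
Local Notation upoly := (@unif_poly R s (jet R s) id (fun=> 1)).
Implicit Types q : jcurves.

Definition bigO k q := exists2 C : R, 0 <= C &
  forall J h, 0 <= h <= 1 -> jnorm (q J h) <= C * h ^+ k.

Lemma bigO_ext k q q' : bigO k q -> (forall J h, q' J h = q J h) -> bigO k q'.
Proof. by move=> [C C0 qC] e; exists C => // J h /qC; rewrite e. Qed.

Lemma unif_poly_bigO k q : upoly k q -> bigO k q.
Proof.
move=> /unif_poly_le -/(_ 1) [C C0 qC]; exists C => // J h /andP[h0 h1].
by have := qC J h; rewrite ger0_norm //; apply.
Qed.

Lemma bigO_weak k l q : (l <= k)%N -> bigO k q -> bigO l q.
Proof.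
move=> lk [C C0 qC]; exists C => // J h h01; rewrite (le_trans (qC J h h01)) //.
by case/andP: h01 => h0 h1; rewrite ler_wpM2l // ler_wiXn2l.
Qed.

Lemma bigO_cst0 k : bigO k (fun J h => 0).
Proof. by exists 0 => // J h _; rewrite jnorm0 mul0r. Qed.

Lemma bigOD k q q' : bigO k q -> bigO k q' -> bigO k (fun J h => q J h + q' J h).
Proof.
move=> [C C0 qC] [C' C'0 qC']; exists (C + C'); first exact: addr_ge0.
move=> J h h01; rewrite (le_trans (jnormD _ _)) // mulrDl.
by rewrite lerD ?qC ?qC'.
Qed.

Lemma bigOZ k (c : R) q : bigO k q -> bigO k (fun J h => c *: q J h).
Proof.
move=> [C C0 qC]; exists (`|c| * C); first exact: mulr_ge0.
by move=> J h h01; rewrite jnormZ -mulrA ler_wpM2l // qC.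
Qed.

Lemma bigON k q : bigO k q -> bigO k (fun J h => - q J h).
Proof. by move=> /(bigOZ (-1))/bigO_ext; apply=> J h; rewrite scaleN1r. Qed.

Lemma bigO_trans k q1 q2 q3 : bigO k (fun J h => q1 J h - q2 J h) ->
  bigO k (fun J h => q2 J h - q3 J h) -> bigO k (fun J h => q1 J h - q3 J h).
Proof.
by move=> q12 q23; apply: bigO_ext (bigOD q12 q23) _ => J h; rewrite subrKA.
Qed.

Lemma bigOMX k q : bigO k q -> bigO k.+1 (fun J h => h *: q J h).
Proof.
move=> [C C0 qC]; exists C => // J h h01.
rewrite jnormZ exprS mulrCA ger0_norm; last by case/andP: h01.
by rewrite ler_wpM2l ?qC //; case/andP: h01.
Qed.

Lemma bigO_sum k (X : Type) (r : seq X) (P : pred X) (q : X -> jcurves) :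
  (forall x, P x -> bigO k (q x)) -> bigO k (fun J h => \sum_(x <- r | P x) q x J h).
Proof.
move=> qk; elim: r => [|x r IH].
  by apply: bigO_ext (bigO_cst0 k) _ => J h; rewrite big_nil.
case Px: (P x); last by apply: bigO_ext IH _ => J h; rewrite big_cons Px.
by apply: bigO_ext (bigOD (qk _ Px) IH) _ => J h; rewrite big_cons Px.
Qed.

Lemma bigO_taylor q : bigO 0 q -> bigO 0 (fun J h => taylor (q J h)).
Proof.
move=> [C C0 qC]; exists (s%:R * (1 + C) ^+ s); first by rewrite mulr_ge0 ?exprn_ge0 ?addr_ge0.
move=> J h h01; rewrite mulr1 taylor_le ?lerDl //.
by rewrite (le_trans (qC J h h01)) // mulr1 lerDr.
Qed.

Lemma bigO_taylorB k q q' : bigO 0 q -> bigO 0 q' ->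
  bigO k (fun J h => q J h - q' J h) ->
  bigO k (fun J h => taylor (q J h) - taylor (q' J h)).
Proof.
move=> [C C0 qC] [C' C'0 qC'] [B B0 qB].
pose M := 1 + C + C'; have M0 : 0 <= M by rewrite !addr_ge0.
exists (s%:R * (s%:R * M ^+ s) * B); first by rewrite !mulr_ge0 ?exprn_ge0.
move=> J h h01; apply: le_trans (@taylor_lipschitz _ _ _ _ _ M _ _ _) _.
- by rewrite (le_trans (qC J h h01)) // mulr1 /M; lra.
- by rewrite (le_trans (qC' J h h01)) // mulr1 /M; lra.
- by rewrite /M; lra.
- by rewrite -[leRHS]mulrA ler_wpM2l ?qB // !mulr_ge0 ?exprn_ge0.
Qed.

Lemma bigO_field q : bigO 1 q -> bigO s (fun J h => jfield (q J h) - taylor (q J h)).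
Proof.
move=> [C C0 qC]; exists (C ^+ s); first exact: exprn_ge0.
move=> J h h01; rewrite (le_trans (jfield_taylor _)) // -exprMn.
case/andP: (h01) => h0 _.
by rewrite lerXn2r ?nnegrE ?jnorm_ge0 ?mulr_ge0 //; have := qC J h h01; rewrite expr1.
Qed.

End bigO.

(** The comparison curve [q] is a nearly exact solution: the energy is differentiated
    along it, and it plays the part of the exact flow. *)
Definition local_error_bound (R : realType) (s S : nat) (a : 'M[R]_S) (b : 'rV[R]_S)
    (C : R) : Prop :=
  forall J : jet R s, exists q q1 : R -> 'rV[R]_(jdim J),
    [/\ q 0 = 0, forall t, is_derive (t : R) (1 : R) q (q1 t) &
    forall t, 0 <= t <= 1 -> [/\ jnorm (q t) <= C * t,
      jnorm (q1 t - jfield (q t)) <= C * t ^+ s &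
      jnorm (rk_step a b (@jfield R s J) t 0 - q t) <= C * t ^+ s.+1]].

Section local_error.
Variables (R : realType) (s S : nat) (a : 'M[R]_S) (b : 'rV[R]_S).
Local Notation jcurves := (@curves R s (jet R s) id).
Local Notation upoly := (@unif_poly R s (jet R s) id (fun=> 1)).

Section stages.
Variable (r : jcurves).
Hypothesis rs : upoly s r.

Let r0 : upoly 0 r.
Proof. by apply: (@unif_poly_weak _ _ _ _ _ _ s); rewrite addn0. Qed.

Let Z (i : 'I_S) : jcurves := fun J h => rsubmx (rk_stage a (suspension (r J)) h 0 i).
Let slope (i : 'I_S) : jcurves :=
  fun J h => taylor (Z i J h) + r J (abscissa a i * h).

Let ZE i J h : Z i J h = h *: \sum_(j < S | (j < i)%N) a i j *: slope j J h.
Proof. exact: suspension_stage. Qed.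

Lemma unif_poly_slope i : upoly 0 (Z i) -> upoly 0 (slope i).
Proof.
move=> Zi; apply: unif_polyD; first exact: unif_poly_taylor.
exact: unif_poly_dilate.
Qed.

Lemma unif_poly_stage i : upoly 0 (Z i).
Proof.
have [k ik] := ubnP (nat_of_ord i); elim: k i ik => // k IH i ik.
have H : upoly 0 (fun J h => \sum_(j < S | (j < i)%N) a i j *: slope j J h).
  apply: unif_poly_sum => j ji; apply: unif_polyZ; apply: unif_poly_slope.
  by apply: IH; rewrite (leq_trans ji).
apply: unif_poly_ext (unif_poly_weak (unif_polyMX 1 H : upoly (1 + 0) _)) _ => J h.
by rewrite ZE expr1.
Qed.

Lemma unif_poly_step :
  upoly 0 (fun J h => rsubmx (rk_step a b (suspension (r J)) h 0)).
Proof.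
have H : upoly 0 (fun J h => \sum_(j < S) b 0 j *: slope j J h).
  apply: unif_poly_sum => j _; apply: unif_polyZ; apply: unif_poly_slope.
  exact: unif_poly_stage.
apply: unif_poly_ext (unif_poly_weak (unif_polyMX 1 H : upoly (1 + 0) _)) _ => J h.
by rewrite suspension_step expr1.
Qed.

Let U (i : 'I_S) : jcurves := fun J h => rk_stage a (@jfield R s J) h 0 i.

(** The slopes differ by the change of the argument of the Taylor polynomial, the Taylor
    remainder of the field, and the correction [r], which is O(h^s). *)
Lemma slope_close i : bigO 1 (U i) -> bigO s.+1 (fun J h => Z i J h - U i J h) ->
  bigO 0 (fun J h => jfield (U i J h)) /\
  bigO s (fun J h => slope i J h - jfield (U i J h)).
Proof.
move=> U1 ZU; have U0 := bigO_weak (leq0n 1) U1.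
have UF := bigO_field U1; split.
  by apply: bigO_ext (bigOD (bigO_weak (leq0n s) UF) (bigO_taylor U0)) _ => J h; rewrite subrK.
have H := bigO_taylorB (unif_poly_bigO (unif_poly_stage i)) U0 (bigO_weak (leqnSn s) ZU).
have H1 := unif_poly_bigO (unif_poly_dilate (abscissa a i) rs).
apply: bigO_ext (bigOD (bigOD H H1) (bigON UF)) _ => J h.
rewrite /slope opprB -[in LHS](subrK (taylor (U i J h)) (taylor (Z i J h))).
by rewrite !addrA; congr (_ - _); rewrite addrAC.
Qed.

Lemma stage_close i : bigO 1 (U i) /\ bigO s.+1 (fun J h => Z i J h - U i J h).
Proof.
have [k ik] := ubnP (nat_of_ord i); elim: k i ik => // k IH i ik.
have UE J h : U i J h = h *: \sum_(j < S | (j < i)%N) a i j *: jfield (U j J h).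
  by rewrite /U rk_stageE add0r.
have IHs (j : 'I_S) : (j < i)%N -> bigO 0 (fun J h => jfield (U j J h)) /\
  bigO s (fun J h => slope j J h - jfield (U j J h)).
  by move=> ji; have [] := IH j (leq_trans ji ik); apply: slope_close.
split.
  have H : bigO 0 (fun J h => \sum_(j < S | (j < i)%N) a i j *: jfield (U j J h)).
    by apply: bigO_sum => j /IHs [H _]; apply: bigOZ.
  exact: bigO_ext (bigOMX H) UE.
have H : bigO s (fun J h => \sum_(j < S | (j < i)%N)
    a i j *: (slope j J h - jfield (U j J h))).
  by apply: bigO_sum => j /IHs [_ H]; apply: bigOZ.
apply: bigO_ext (bigOMX H) _ => J h.
rewrite UE ZE -scalerBr -sumrB; congr (_ *: _).
by apply: eq_bigr => j _; rewrite scalerBr.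
Qed.

Lemma step_close : bigO s.+1 (fun J h =>
  rk_step a b (@jfield R s J) h 0 - rsubmx (rk_step a b (suspension (r J)) h 0)).
Proof.
have H : bigO s (fun J h => \sum_(j < S) b 0 j *: (slope j J h - jfield (U j J h))).
  by apply: bigO_sum => j _; apply: bigOZ; apply: (slope_close (stage_close j).1 (stage_close j).2).2.
apply: bigO_ext (bigON (bigOMX H)) _ => J h.
rewrite suspension_step /rk_step add0r -scalerBr -scalerN -sumrB -sumrN.
by congr (_ *: _); apply: eq_bigr => j _; rewrite scalerBr opprB.
Qed.

End stages.

Hypothesis rk_order : rk_has_order a b s.

Theorem uniform_local_error :
  exists2 C : R, 0 <= C & local_error_bound s a b C.
Proof.
have [q [q1 [qO1 q1O0 dq rs]]] := picard_curve R s.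
pose r : jcurves := fun J t => q1 J t - taylor (q J t).
have q0 := unif_poly_weak (qO1 : upoly (1 + 0) q).
have Dq : upoly s.+1 (fun J h => rsubmx (rk_step a b (suspension (r J)) h 0) - q J h).
  apply: unif_poly_flat => [|J]; first exact: unif_polyB (unif_poly_step rs) q0.
  have [n [C [v [_ vE]]]] := rs.
  have sm : smooth (suspension (r J)) := @smooth_suspension _ _ _ _ n (v J) _ (vE J).
  have fl := @suspension_flow _ _ J (r J) _ _ (unif_poly_at0 qO1 J) (dq J) (fun t => erefl).
  have [B HB] := rk_order sm fl; exists B; apply: filterS HB => h.
  apply: le_trans; rewrite (le_trans _ (enorm_rsubmx_le _)) //.
  by rewrite raddfB /= row_mxKr.
have [C1 C10 H1] := unif_poly_bigO qO1.
have [C2 C20 H2] : bigO s (fun J t => q1 J t - jfield (q J t)).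
  apply: bigO_trans (unif_poly_bigO rs) _.
  apply: bigO_ext (bigON (bigO_field (unif_poly_bigO qO1))) _ => J h.
  by rewrite opprB.
have [C3 C30 H3] := bigO_trans (step_close rs) (unif_poly_bigO Dq).
exists (C1 + C2 + C3); first by rewrite !addr_ge0.
move=> J; exists (q J), (q1 J); split=> //; first exact: unif_poly_at0 qO1 J.
move=> t t01; have /andP[t0 _] := t01; split.
- by rewrite (le_trans (H1 J t t01)) // expr1 ler_wpM2r //; lra.
- by rewrite (le_trans (H2 J t t01)) // ler_wpM2r ?exprn_ge0 //; lra.
- by rewrite (le_trans (H3 J t t01)) // ler_wpM2r ?exprn_ge0 //; lra.
Qed.

End local_error.

(** * Iterated derivatives and Taylor expansion *)

Section iterated_derivatives.
Variables (R : realType) (V : normedModType R) (n : nat) (f : V -> R).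
Hypothesis fn : times_differentiable n f.

(** Multilinearity comes from the linearity of one differential; it then passes
    through the outer directional derivatives. *)
Lemma iter_derive_linear us vs (c : R) u v : (size us + size vs < n)%N ->
  iter_derive f (us ++ (c *: u + v) :: vs) =
  (fun x => c * iter_derive f (us ++ u :: vs) x + iter_derive f (us ++ v :: vs) x).
Proof.
elim: us => [|w us IH] /= sz; apply/funext => x.
  have dg : differentiable (iter_derive f vs) x by apply: fn.
  by rewrite !deriveE // linearP.
rewrite IH; last exact: ltnW.
have dv z : derivable (iter_derive f (us ++ z :: vs)) x w.
  by apply/diff_derivable/fn; rewrite size_cat /= addnS.
have -> : (fun y => c * iter_derive f (us ++ u :: vs) y + iter_derive f (us ++ v :: vs) y)
   = c \*: iter_derive f (us ++ u :: vs) + iter_derive f (us ++ v :: vs) by [].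
by rewrite deriveD ?deriveZ //; apply: derivableZ.
Qed.

Lemma iter_derive0 us vs x : (size us + size vs < n)%N ->
  iter_derive f (us ++ 0 :: vs) x = 0.
Proof.
move=> sz; have := iter_derive_linear (-1) 0 0 sz.
by rewrite scaler0 addr0 => ->; rewrite mulN1r addNr.
Qed.

Lemma iter_deriveZ us vs (c : R) u x : (size us + size vs < n)%N ->
  iter_derive f (us ++ (c *: u) :: vs) x = c * iter_derive f (us ++ u :: vs) x.
Proof.
move=> sz; have := iter_derive_linear c u 0 sz.
by rewrite addr0 => ->; rewrite iter_derive0 // addr0.
Qed.

Lemma iter_derive_sum (I : Type) (r : seq I) (F : I -> V) us vs x :
  (size us + size vs < n)%N ->
  iter_derive f (us ++ (\sum_(i <- r) F i) :: vs) x =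
  \sum_(i <- r) iter_derive f (us ++ F i :: vs) x.
Proof.
move=> sz; elim: r => [|i r IH]; first by rewrite !big_nil iter_derive0.
rewrite !big_cons -IH; have := iter_derive_linear 1 (F i) (\sum_(j <- r) F j) sz.
by rewrite scale1r => ->; rewrite mul1r.
Qed.

End iterated_derivatives.

Lemma is_derive_comp_curve (R : realType) (V W : normedModType R) (F : V -> W)
    (p : R -> V) (t : R) (dp : V) :
  is_derive t (1 : R) p dp -> differentiable F (p t) ->
  is_derive t (1 : R) (F \o p) ('D_dp F (p t)).
Proof.
move=> dpt dF; have dfp : differentiable p t by apply/derivable1_diffP; apply: ex_derive.
have dc : differentiable (F \o p) t by apply: differentiable_comp.
apply: DeriveDef; first exact/derivable1_diffP.
by rewrite deriveE // diff_comp //= -(deriveE _ dfp) (@derive_val _ _ _ _ _ _ _ dpt) deriveE.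
Qed.

Lemma is_derive_line (R : realType) (V W : normedModType R) (F : V -> W) (x u : V) (t : R) :
  differentiable F (x + t *: u) ->
  is_derive t (1 : R) (fun t => F (x + t *: u)) ('D_u F (x + t *: u)).
Proof.
move=> dF; apply: (@is_derive_comp_curve _ _ _ F (fun t => x + t *: u)) => //.
have dl : differentiable (fun t : R => t *: u) t by apply: differentiableZl.
have -> : (fun t : R => x + t *: u) = cst x + (fun t : R => t *: u) by [].
apply: DeriveDef; first by apply/derivable1_diffP/differentiableD.
rewrite deriveD; [|exact: derivable_cst|exact/derivable1_diffP].
by rewrite derive_cst add0r deriveE // diffZl // -deriveE // derive_id scale1r.
Qed.

Lemma mean_value_bound (R : realType) (h dh : R -> R) (t B : R) :
  (forall x, is_derive (x : R) (1 : R) h (dh x)) -> h 0 = 0 -> 0 <= t ->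
  (forall x, 0 <= x <= t -> `|dh x| <= B) -> `|h t| <= B * t.
Proof.
move=> hd h0 t0 dhB; have hc : {within `[0, t], continuous h}.
  by apply: derivable_within_continuous => x _; apply: ex_derive.
have [x xin] := @MVT_segment R h dh 0 t t0 (fun x _ => hd x) hc.
rewrite h0 !subr0 => ->; rewrite normrM (ger0_norm t0) ler_wpM2r //.
by apply: dhB; move: xin; rewrite in_itv.
Qed.

(** A chain of functions, each the derivative of the preceding one, accommodates a last
    derivative that merely exists, like the highest ones of the objective. *)
Lemma taylor_bound (R : realType) (n : nat) (g : nat -> R -> R) (B : R) :
  (forall k, (k < n)%N -> forall t, is_derive (t : R) (1 : R) (g k) (g k.+1 t)) ->
  (forall t, 0 <= t <= 1 -> `|g n t| <= B) ->
  forall t, 0 <= t <= 1 ->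
    `|g 0%N t - \sum_(k < n) t ^+ k / k`!%:R * g k 0| <= B * t ^+ n.
Proof.
elim: n g => [|n IH] g gd gB t t01.
  by rewrite big_ord0 subr0 mulr1 gB.
have /andP[t0 t1] := t01.
pose h (x : R) := g 0%N x - \sum_(k < n.+1) x ^+ k / k`!%:R * g k 0.
pose dh (x : R) := g 1%N x - \sum_(k < n) x ^+ k / k`!%:R * g k.+1 0.
rewrite exprSr mulrA; apply: (@mean_value_bound _ h dh) => //.
- move=> x.
  have -> : h = g 0%N - (cst (g 0%N 0) + \sum_(k < n) (fun x : R => (k.+1)`!%:R^-1 * g k.+1 0 * x ^+ k.+1)).
    apply/funext => y; rewrite /h !fctE fct_sumE big_ord_recl expr0 mul1r fact0 invr1 mul1r.
    by congr (_ - (_ + _)); apply: eq_bigr => k _; rewrite -mulrA mulrC.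
  apply: is_deriveB; first exact: gd.
  rewrite -[X in is_derive _ _ _ X]add0r; apply: is_deriveD.
  apply: is_derive_sum => k.
  have dX : is_derive x (1 : R) (fun x : R => x ^+ k.+1) (k.+1%:R * x ^+ k).
    apply: DeriveDef; first exact: exprn_derivable.
    by rewrite exp_derive /= /GRing.scale /= mulr1.
  apply: is_derive_eq (is_deriveZ ((k.+1)`!%:R^-1 * g k.+1 0) dX) _.
  have k1 : k.+1%:R != 0 :> R by rewrite pnatr_eq0.
  have kf : k`!%:R != 0 :> R by rewrite pnatr_eq0 -lt0n fact_gt0.
  rewrite factS natrM /GRing.scale /=.
  move: (k.+1%:R : R) (k`!%:R : R) k1 kf => A B' A0 B'0.
  by field; rewrite A0 B'0.
- rewrite /h big_ord_recl expr0 fact0 divr1 mul1r big1 ?addr0 ?subrr // => k _.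
  by rewrite expr0n mul0r mul0r.
move=> x /andP[x0 xt].
apply: (le_trans (IH (fun k => g k.+1) _ _ x _)).
- by move=> k kn; apply: gd.
- exact: gB.
- by rewrite x0 (le_trans xt).
have B0 : 0 <= B by rewrite (le_trans _ (gB t t01)).
by rewrite ler_wpM2l // lerXn2r ?nnegrE.
Qed.

Section gradient.
Variables (R : realType) (d s : nat) (L : R) (f : 'rV[R]_d -> R).
Hypothesis fs : times_differentiable s.+1 f.
Hypothesis fL : forall (n : nat) (x : 'rV[R]_d), (2 <= n <= s.+1)%N ->
  (tensor_norm (nabla n f x) <= L%:E)%E.

Lemma unit_iter_derive_le us x : (2 <= size us <= s.+1)%N ->
  (forall u, u \in us -> enorm u = 1) -> iter_derive f us x <= L.
Proof.
move=> sz us1; rewrite -lee_fin (le_trans _ (fL x sz)) //.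
apply: ereal_sup_ubound; exists (in_tuple us) => //= i.
by rewrite us1 // mem_tnth.
Qed.

(** The bound for unit vectors extends by homogeneity, normalising the arguments one at a
    time. Changing the sign of one argument turns the supremum into a bound on the
    absolute value. *)
Lemma norm_iter_derive_le us x : (2 <= size us <= s.+1)%N ->
  `|iter_derive f us x| <= L * \prod_(u <- us) enorm u.
Proof.
move=> sz.
suff H vs ws : (size vs + size ws = size us)%N ->
    (forall u, u \in vs -> enorm u = 1) ->
    `|iter_derive f (vs ++ ws) x| <= L * \prod_(u <- ws) enorm u.
  by have := H [::] us erefl; apply.
elim: ws vs => [|w ws IH] vs szv vs1.
  rewrite cats0 big_nil mulr1 ler_norml; rewrite addn0 in szv.
  rewrite (unit_iter_derive_le _ _ vs1) ?szv // andbT.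
  case: vs szv vs1 => [e|v vs szv vs1]; first by rewrite -e in sz.
  have := @iter_deriveZ _ _ s.+1 f fs [::] vs (-1) v x.
  rewrite -szv in sz; case/andP: sz => sz1 sz2.
  move=> /(_ sz2) /=; rewrite mulN1r lerNl => <-.
  apply: (@unit_iter_derive_le (-1 *: v :: vs)); first by rewrite /= sz1.
  move=> u; rewrite in_cons => /predU1P[->|uvs].
    by rewrite scaleN1r enormN vs1 // mem_head.
  by rewrite vs1 // in_cons uvs orbT.
have lts : (size vs + size ws < s.+1)%N.
  by case/andP: sz => _; rewrite -szv /= addnS.
rewrite big_cons; have [w0|w0] := eqVneq (enorm w) 0.
  by rewrite (enorm_eq0 w0) (iter_derive0 fs) // normr0 enorm0 mul0r mulr0.
rewrite -[w in iter_derive _ (_ ++ w :: _)](scalerKV w0) (iter_deriveZ fs) //.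
rewrite normrM (ger0_norm (enorm_ge0 _)) mulrCA ler_wpM2l ?enorm_ge0 //.
rewrite -cat_rcons; apply: IH => [|u]; first by rewrite size_rcons addSnnS.
rewrite mem_rcons in_cons => /predU1P[->|]; last exact: vs1.
by rewrite enormZ ger0_norm ?invr_ge0 ?enorm_ge0 // mulVf.
Qed.

(** The derivative of order [size us] of the gradient, applied to [us]. The coordinate
    direction is the innermost derivative, as in [grad]. *)
Definition gradn us x : 'rV[R]_d := \row_i iter_derive f (rcons us (delta_mx 0 i)) x.

Lemma inner_gradn us x v : (size us <= s)%N ->
  inner (gradn us x) v = iter_derive f (rcons us v) x.
Proof.
move=> sz; rewrite [in RHS](row_sum_delta v) -cats1 (iter_derive_sum fs) ?addn0 //.
apply: eq_bigr => i _; rewrite (iter_deriveZ fs) ?addn0 // mxE cats1 mulrC //.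
Qed.

Lemma gradE x : grad f x = gradn [::] x.
Proof. by []. Qed.

Lemma inner_grad x v : inner (grad f x) v = 'D_v f x.
Proof. by rewrite gradE inner_gradn. Qed.

Lemma enorm_gradn_le us x : 0 <= L -> (1 <= size us <= s)%N ->
  enorm (gradn us x) <= L * \prod_(u <- us) enorm u.
Proof.
move=> L0 /andP[s1 s2]; apply: enorm_le_dual.
  by rewrite mulr_ge0 // prodr_ge0 // => i _; apply: enorm_ge0.
move=> v; rewrite inner_gradn // (le_trans (ler_norm _)) //.
rewrite (le_trans (norm_iter_derive_le _ _)) ?size_rcons ?ltnS ?s1 //.
by rewrite -cats1 big_cat big_seq1 mulrA.
Qed.

Lemma line_derivative us x u (t : R) : (size us <= s)%N ->
  is_derive t (1 : R) (fun t => iter_derive f us (x + t *: u))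
    (iter_derive f (u :: us) (x + t *: u)).
Proof. by move=> sz; apply: is_derive_line; apply: fs. Qed.

(** Pairing with a fixed vector reduces the statement to one real function on a segment,
    whose derivatives are values of the iterated derivatives of [f]. *)
Lemma grad_taylor x u : 0 <= L -> (1 <= s)%N ->
  enorm (grad f (x + u) - \sum_(k < s) (k`!%:R)^-1 *: gradn (nseq k u) x) <=
  L * enorm u ^+ s.
Proof.
move=> L0 s1; apply: enorm_le_dual; first by rewrite mulr_ge0 ?exprn_ge0 ?enorm_ge0.
move=> v; pose g k (t : R) := iter_derive f (rcons (nseq k u) v) (x + t *: u).
have gd k : (k < s)%N -> forall t, is_derive (t : R) (1 : R) (g k) (g k.+1 t).
  by move=> ks t; apply: line_derivative; rewrite size_rcons size_nseq.
have gB t : 0 <= t <= 1 -> `|g s t| <= L * enorm u ^+ s * enorm v.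
  move=> _; rewrite (le_trans (norm_iter_derive_le _ _)) ?size_rcons ?size_nseq ?ltnS ?s1 //=.
  by rewrite -cats1 big_cat big_seq1 big_nseq iter_mulr_1 mulrA.
have := taylor_bound gd gB (t := 1); rewrite ler01 lexx => /(_ isT).
rewrite expr1n mulr1; apply: le_trans; apply: le_trans (ler_norm _).
rewrite innerDl innerNl inner_grad /g scale1r lerD2l lerN2.
rewrite /inner; under [X in _ <= X]eq_bigr do rewrite summxE mulr_suml.
rewrite exchange_big /=; apply: ler_sum => k _.
rewrite expr1n scale0r addr0 -inner_gradn ?size_nseq; last exact: ltnW.
by rewrite mulr_sumr; apply: ler_sum => i _; rewrite !mxE mul1r mulrA.
Qed.

Lemma first_order_bound x u : (1 <= s)%N ->
  `|f (x + u) - f x - inner (grad f x) u| <= L * enorm u ^+ 2.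
Proof.
move=> s1; pose g k (t : R) := iter_derive f (nseq k u) (x + t *: u).
have gd k : (k < 2)%N -> forall t, is_derive (t : R) (1 : R) (g k) (g k.+1 t).
  move=> ks t; apply: line_derivative; rewrite size_nseq.
  by rewrite (leq_trans _ s1).
have gB t : 0 <= t <= 1 -> `|g 2 t| <= L * enorm u ^+ 2.
  move=> _; rewrite (le_trans (norm_iter_derive_le _ _)) //.
  by rewrite big_nseq iter_mulr_1.
have := taylor_bound gd gB (t := 1); rewrite ler01 lexx => /(_ isT).
rewrite expr1n mulr1 !big_ord_recl big_ord0 /g /= !scale1r !scale0r !addr0.
by rewrite inner_grad expr0 fact0 factS fact0 muln1 expr1n divr1 !mul1r opprD addrA.
Qed.

End gradient.

(** * The admissible step size *)

Section step_size.
Variables (R : realType) (s : nat).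
Hypothesis s1 : (1 <= s)%N.
Local Notation gamma := (@rate_exponent R s).

(** The thresholds 1/64 and 1/288 are those of [lyapunov_step]; 9^(s+1) comes from the
    time scale 1 / (9 sqrt(max(E, Q))), and 4 bounds the powers of max(E, Q) with exponent
    in [-1, 0], since max(E, Q) >= 1/4. *)
Definition step_scale (A : R) : R := (288 * A * 4 * 9 ^+ s.+1)^-1.

Fact natS_gt0 (n : nat) : 0 < n.+1%:R :> R. Proof. exact: ltr0Sn. Qed.

Fact scale_num_gt0 (A : R) : 0 < A -> 0 < 288 * A * 4.
Proof. by move=> A0; exact: (mulr_gt0 (mulr_gt0 (natS_gt0 287) A0) (natS_gt0 3)). Qed.

Fact scale_denom_gt0 (A : R) : 0 < A -> 0 < 288 * A * 4 * 9 ^+ s.+1.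
Proof. by move=> A0; exact: (mulr_gt0 (scale_num_gt0 A0) (exprn_gt0 _ (natS_gt0 8))). Qed.

Lemma step_scale_gt0 (A : R) : 0 < A -> 0 < step_scale A.
Proof. by move=> A0; rewrite invr_gt0; exact: scale_denom_gt0. Qed.

Lemma powRN_le4 (Lam e : R) : 1 / 4 <= Lam -> 0 <= e <= 1 -> Lam `^ (- e) <= 4.
Proof.
move=> L4 /andP[e0 e1]; have L0 : 0 < Lam by apply: lt_le_trans L4; lra.
rewrite powRN invf_ple ?posrE ?powR_gt0 //.
have q : 4^-1 = (1 / 4 : R) by rewrite div1r.
rewrite q; apply: (@le_trans _ _ ((1 / 4) `^ e)); last first.
  by rewrite ge0_ler_powR // nnegrE; lra.
by rewrite ger1_powR // ; lra.
Qed.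

Lemma gamma_ge0 : 0 <= gamma.
Proof. by rewrite divr_ge0. Qed.

Lemma gamma_le1 : gamma <= 1.
Proof.
rewrite ler_pdivrMr ?mul1r; last by rewrite mulr_gt0 // ltr0n addn1.
by rewrite -natrM ler_nat mul2n -addnn -addnA leq_add2l add1n addn1.
Qed.

(** The powers of [Lam] that remain are -1/(s+1) in the first bound and
    -(s-1)/(2(s+1)) in the second; both lie in [-1, 0]. *)
Lemma step_size_small (A Lam h : R) : 1 <= A -> 1 / 4 <= Lam -> 0 < h ->
  h * Lam `^ gamma <= step_scale A ->
  64 * A * (9 * Num.sqrt Lam * h) <= 1 /\
  288 * A * (9 * Num.sqrt Lam * (9 * Num.sqrt Lam * h) ^+ s) <= 1.
Proof.
move=> A1 L4 h0; have L0 : 0 < Lam by apply: lt_le_trans L4; lra.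
set g := Lam `^ gamma; set k := step_scale A => hg.
have A0 : 0 < A by apply: lt_le_trans A1.
have g0 : 0 < g by apply: powR_gt0.
have k0 : 0 < k := step_scale_gt0 A0.
have kE : k * (288 * A * 4 * 9 ^+ s.+1) = 1.
  exact: (mulVf (lt0r_neq0 (scale_denom_gt0 A0))).
have n9 : 1 <= 9 ^+ s :> R by rewrite exprn_ege1 //; lra.
have hk : h <= k / g by rewrite ler_pdivlMr.
set r := Num.sqrt Lam; have r0 : 0 <= r by apply: sqrtr_ge0.
have rE : r = Lam `^ (2^-1) by rewrite powR12_sqrt // ltW.
have s0 : (s + 1)%:R != 0 :> R by rewrite pnatr_eq0 addn1.
have L1 : Lam != 0 by rewrite gt_eqF.
have rg : r / g <= 4.
  rewrite rE -powRB ?L1 ?implybT //.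
  have -> : 2^-1 - gamma = - ((s + 1)%:R^-1).
    rewrite /rate_exponent (_ : (s + 3)%:R = (s + 1)%:R + 2 :> R); last by rewrite -natrD -addnA.
    by field.
  have sp : 0 < (s + 1)%:R :> R by rewrite ltr0n addn1.
  by apply: powRN_le4 => //; rewrite invr_ge0 (ltW sp) /= invf_le1 // ler1n addn1.
have rgs : r ^+ s.+1 / g ^+ s <= 4.
  rewrite rE -!powR_mulrn ?powR_ge0 // -!powRrM -powRB ?L1 ?implybT //.
  have -> : 2^-1 * s.+1%:R - gamma * s%:R = - ((s.-1)%:R / (2 * (s + 1)%:R)) :> R.
    rewrite /rate_exponent -[in s%:R](prednK s1) -[in s.+1%:R](prednK s1).
    rewrite !natrD in s0 *; rewrite -[in s%:R](prednK s1) in s0 *.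
    rewrite -!natr1 in s0 *; set n := s.-1%:R in s0 *.
    by field.
  apply: powRN_le4 => //; rewrite divr_ge0 //=.
  rewrite ler_pdivrMr ?mul1r; last by rewrite mulr_gt0 // ltr0n addn1.
  rewrite -natrM ler_nat (leq_trans (leq_pred s)) // mulnDr.
  by rewrite (leq_trans (leq_pmull s (isT : 0 < 2)%N)) // leq_addr.
have kA : k * (288 * A * 4 * 9) <= 1.
  rewrite -[leRHS]kE; apply: (ler_wpM2l (ltW k0)); rewrite exprS mulrA.
  exact: (ler_peMr (mulr_ge0 (ltW (scale_num_gt0 A0)) (ltW (natS_gt0 8))) n9).
split.
  have rh : r * h <= k * 4.
    apply: (le_trans (ler_wpM2l r0 hk)).
    by rewrite mulrCA mulrC [leRHS]mulrC ler_wpM2r // ltW.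
  have := ler_wpM2l (ltW A0) rh; move: kA; have := mulr_gt0 A0 k0.
  by clear; lra.
have h0' := ltW h0.
have hks : r ^+ s.+1 * h ^+ s <= k ^+ s * 4.
  have hs : h ^+ s <= (k / g) ^+ s.
    by rewrite lerXn2r ?nnegrE // divr_ge0 // ltW.
  apply: (le_trans (ler_wpM2l (exprn_ge0 s.+1 r0) hs)).
  rewrite expr_div_n mulrCA mulrC [leRHS]mulrC ler_wpM2r //.
  by rewrite exprn_ge0 // ltW.
have k1 : k <= 1.
  rewrite invf_le1; last exact: scale_denom_gt0.
  rewrite exprS; have : 1 <= A * 9 ^+ s by apply: mulr_ege1.
  by clear; lra.
have ks : k ^+ s <= k by case: s s1 => [//|n] _; rewrite exprS ler_piMr ?exprn_ile1 // ltW.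
have -> : 288 * A * (9 * r * (9 * r * h) ^+ s) = 288 * A * 9 ^+ s.+1 * (r ^+ s.+1 * h ^+ s).
  by rewrite !exprMn !exprS; ring.
rewrite -[leRHS]kE.
have P0 : 0 <= 288 * A * 9 ^+ s.+1 by exact: (mulr_ge0 (mulr_ge0 (ltW (natS_gt0 287)) (ltW A0)) (exprn_ge0 _ (ltW (natS_gt0 8)))).
apply: (le_trans (ler_wpM2l P0 hks)).
have := ler_wpM2l P0 ks; clear; lra.
Qed.

Lemma step_size_mono (h E1 E0 Q k : R) : 0 <= h -> 0 <= Q -> E1 <= E0 ->
  h * Num.max E0 Q `^ gamma <= k -> h * Num.max E1 Q `^ gamma <= k.
Proof.
move=> h0 Q0 E10; apply: le_trans; rewrite ler_wpM2l //.
apply: ge0_ler_powR; rewrite ?gamma_ge0 ?nnegrE //.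
- by rewrite le_max Q0 orbT.
- by rewrite le_max Q0 orbT.
by rewrite ge_max !le_max E10 lexx orbT.
Qed.

Lemma step_boundE (A E Q : R) : 0 < A -> 0 <= E -> 0 < Q ->
  step_bound s ((2 * step_scale A)^-1 ^+ s.+1) E Q =
  step_scale A / Num.max E Q `^ gamma.
Proof.
move=> A0 E0 Q0; rewrite /step_bound.
have k0 := step_scale_gt0 A0.
have i0 : 0 <= (2 * step_scale A)^-1 by rewrite invr_ge0 mulr_ge0 // ltW.
have -> : ((2 * step_scale A)^-1 ^+ s.+1) `^ (1 / (s + 1)%:R) = (2 * step_scale A)^-1.
  rewrite -powR_mulrn // -powRrM addn1 mul1r divff ?pnatr_eq0 // powRr1 //.
rewrite [RHS]mulrC; congr (_ * _); last by field; rewrite gt_eqF.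
have [->|E1] := eqVneq E 0; first by rewrite max_r ?ltW // powRN.
have Ep : 0 < E by rewrite lt_neqAle eq_sym E1.
rewrite !powRN /Num.max; have [EQ|QE] := ltP E Q.
  rewrite min_r // lef_pV2 ?posrE ?powR_gt0 //.
  by rewrite ge0_ler_powR ?gamma_ge0 ?nnegrE // ltW.
rewrite min_l // lef_pV2 ?posrE ?powR_gt0 //.
by rewrite ge0_ler_powR ?gamma_ge0 ?nnegrE // ltW.
Qed.

End step_size.

(** * The accelerated vector field *)

Lemma inner_row_mx (R : realType) m n (u1 v1 : 'rV[R]_m) (u2 v2 : 'rV[R]_n) :
  inner (row_mx u1 u2) (row_mx v1 v2) = inner u1 v1 + inner u2 v2.
Proof.
rewrite /inner big_split_ord /=; congr (_ + _); apply: eq_bigr => i _.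
  by rewrite !row_mxEl.
by rewrite !row_mxEr.
Qed.

Lemma enorm_row_mx_le (R : realType) m n (u : 'rV[R]_m) (v : 'rV[R]_n) :
  enorm (row_mx u v) <= enorm u + enorm v.
Proof.
rewrite -(@ler_pXn2r _ 2) ?nnegrE ?addr_ge0 ?enorm_ge0 //.
rewrite sqr_enorm inner_row_mx sqrrD -!sqr_enorm.
by have := mulr_ge0 (enorm_ge0 u) (enorm_ge0 v); lra.
Qed.

Lemma enorm_lsubmx_le (R : realType) m n (z : 'rV[R]_(m + n)) : enorm (lsubmx z) <= enorm z.
Proof.
rewrite ler_sqrt ?inner_ge0 // -[z in leRHS]hsubmxK inner_row_mx lerDl.
exact: inner_ge0.
Qed.

Lemma lsubmxD (R : realType) m n (u v : 'rV[R]_(m + n)) :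
  lsubmx (u + v) = lsubmx u + lsubmx v.
Proof. by apply/rowP => i; rewrite !mxE. Qed.

Lemma rsubmxD (R : realType) m n (u v : 'rV[R]_(m + n)) :
  rsubmx (u + v) = rsubmx u + rsubmx v.
Proof. by apply/rowP => i; rewrite !mxE. Qed.

Lemma is_derive_lsubmx (R : realType) m n (p : R -> 'rV[R]_(m + n)) (t : R) dp :
  is_derive t (1 : R) p dp -> is_derive t (1 : R) (fun x => lsubmx (p x)) (lsubmx dp).
Proof.
move=> pd; apply: is_derive_mx => i j; rewrite mxE.
have -> : (fun x => lsubmx (p x) i j) = (fun x => p x i (lshift n j)).
  by apply/funext => x; rewrite mxE.
exact: is_derive_entry.
Qed.

Lemma is_derive_rsubmx (R : realType) m n (p : R -> 'rV[R]_(m + n)) (t : R) dp :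
  is_derive t (1 : R) p dp -> is_derive t (1 : R) (fun x => rsubmx (p x)) (rsubmx dp).
Proof.
move=> pd; apply: is_derive_mx => i j; rewrite mxE.
have -> : (fun x => rsubmx (p x) i j) = (fun x => p x i (rshift m j)).
  by apply/funext => x; rewrite mxE.
exact: is_derive_entry.
Qed.

Lemma is_derive_sqr_enorm (R : realType) m (p : R -> 'rV[R]_m) (t : R) dp :
  is_derive t (1 : R) p dp ->
  is_derive t (1 : R) (fun x => enorm (p x) ^+ 2) (2 * inner (p t) dp).
Proof.
move=> pd; have -> : (fun x => enorm (p x) ^+ 2) = \sum_(i < m) (fun x => p x 0 i ^+ 2).
  by apply/funext => x; rewrite sqr_enorm fct_sumE; apply: eq_bigr => i _; rewrite expr2.
rewrite mulr_sumr; apply: is_derive_sum => i.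
have di := is_derive_entry 0 i pd.
have -> : (fun x => p x 0 i ^+ 2) = (fun x => p x 0 i) * (fun x => p x 0 i).
  by apply/funext => x; rewrite expr2.
apply: is_derive_eq (is_deriveM di di) _.
by rewrite /GRing.scale /=; ring.
Qed.

(** Runge-Kutta methods commute with translations and with a change of the unit of time. *)
Lemma rk_step_rescale (R : realType) S (a : 'M[R]_S) (b : 'rV[R]_S) (V : lmodType R)
    (G : V -> V) (h c : R) (y : V) : c != 0 ->
  rk_step a b G h y = y + rk_step a b (fun u => c^-1 *: G (y + u)) (c * h) 0.
Proof.
move=> c0; pose g u := c^-1 *: G (y + u).
have fold_sum (w : 'I_S -> R) (P : pred 'I_S) (z : 'I_S -> V) :
    h *: \sum_(j < S | P j) w j *: G (y + z j) =
    (c * h) *: \sum_(j < S | P j) w j *: g (z j).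
  rewrite !scaler_sumr; apply: eq_bigr => j _; rewrite !scalerA; congr (_ *: _).
  by field.
have stE i : rk_stage a G h y i = y + rk_stage a g (c * h) 0 i.
  have [k ik] := ubnP (nat_of_ord i); elim: k i ik => // k IH i ik.
  rewrite !rk_stageE add0r -fold_sum; congr (_ + _ *: _).
  by apply: eq_bigr => j ji; rewrite IH // (leq_trans ji).
rewrite /rk_step add0r -/g -fold_sum; congr (_ + _ *: _).
by apply: eq_bigr => j _; rewrite stE.
Qed.

Lemma rk_step_fixed (R : realType) S (a : 'M[R]_S) (b : 'rV[R]_S) (V : lmodType R)
    (G : V -> V) (h : R) (y : V) : G y = 0 -> rk_step a b G h y = y.
Proof.
move=> Gy; have stE i : rk_stage a G h y i = y.
  have [k ik] := ubnP (nat_of_ord i); elim: k i ik => // k IH i ik.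
  rewrite rk_stageE big1 ?scaler0 ?addr0 // => j ji.
  by rewrite IH ?Gy ?scaler0 // (leq_trans ji).
rewrite /rk_step big1 ?scaler0 ?addr0 // => j _.
by rewrite stE Gy scaler0.
Qed.

Lemma sqr1D_ge (R : realType) (C : R) : 0 <= C ->
  [/\ 1 <= (1 + C) ^+ 2, C <= (1 + C) ^+ 2, C * C <= (1 + C) ^+ 2 &
      36 * C + 7 * (C * C) <= 36 * (1 + C) ^+ 2].
Proof.
move=> C0; have CC := mulr_ge0 C0 C0.
have -> : (1 + C) ^+ 2 = 1 + 2 * C + C * C by ring.
by split; lra.
Qed.

Lemma small_step_arith (R : realType) (h z A : R) : 0 < h -> 9 * (1 / 2) * h <= z ->
  z <= A * z -> 64 * A * z <= 1 -> 0 <= 1 - h / 4 <= 1.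
Proof. by move=> h0 H1 H2 H3; apply/andP; split; lra. Qed.

Lemma energy_growth_arith (R : realType) (X Et Ey : R) : 64 * X <= 1 -> 0 <= Ey ->
  Et - Ey <= 16 * X * Ey -> Et <= 2 ^+ 2 * Ey.
Proof.
move=> HX Ey0 H; have : 16 * X * Ey <= Ey by rewrite ler_piMl //; lra.
by rewrite expr2; lra.
Qed.

Lemma energy_rate_arith (R : realType) (D1 D2 T Et Ey X Z : R) :
  D1 <= - (1 / 2) * Et -> D2 <= T -> T <= 18 * Z * Ey ->
  - (16 * X * Ey) <= Et - Ey ->
  D1 + D2 <= Ey * (- (1 / 2) + 8 * X + 18 * Z).
Proof. by move=> H1 H2 H3 H4; lra. Qed.

Lemma energy_budget_arith (R : realType) (A C X Y E0 E1 E2 h : R) :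
  0 <= h -> 0 <= E0 -> 0 <= Y -> 36 * C + 7 * (C * C) <= 36 * A ->
  64 * X <= 1 -> 288 * A * Y <= 1 ->
  E1 <= E0 + h * (E0 * (- (1 / 2) + 8 * X + 18 * (C * Y))) ->
  E2 - E1 <= h * (E0 * (18 * (C * Y) + 7 * (C * C * Y))) ->
  E2 <= (1 - h / 4) * E0.
Proof.
move=> h0 E00 Y0 CA HX HY H1 H2.
have F1 := ler_wpM2r Y0 CA.
have F : - (1 / 2) + 8 * X + 18 * (C * Y) + (18 * (C * Y) + 7 * (C * C * Y)) <= - (1 / 4).
  by lra.
have := ler_wpM2l h0 (ler_wpM2l E00 F); lra.
Qed.

Section accelerated_flow_theory.
Variables (R : realType) (d s : nat) (mu L : R) (f : 'rV[R]_d -> R) (xs : 'rV[R]_d).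
Hypotheses (s1 : (1 <= s)%N) (d1 : (1 <= d)%N) (mu0 : 0 < mu) (L0 : 0 < L).
Hypothesis xs_min : forall x, f xs <= f x.
Hypothesis f_qsc : quasi_strongly_convex mu f xs.
Hypothesis fs : times_differentiable s.+1 f.
Hypothesis fL : forall (n : nat) (x : 'rV[R]_d), (2 <= n <= s.+1)%N ->
  (tensor_norm (nabla n f x) <= L%:E)%E.

Variable Q : R.
Hypothesis QE : L = mu * Q.
Let rQ := Num.sqrt Q.

Let Q0 : 0 < Q. Proof. by move: L0; rewrite QE pmulr_rgt0. Qed.
Let rQ0 : 0 < rQ. Proof. by rewrite sqrtr_gt0. Qed.
Let rQ2 : rQ ^+ 2 = Q. Proof. by rewrite sqr_sqrtr // ltW. Qed.

Let Q_ge0 : 0 <= Q. Proof. exact: ltW. Qed.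
Let rQ_ge0 : 0 <= rQ. Proof. exact: ltW. Qed.
Let L_ge0 : 0 <= L. Proof. exact: ltW. Qed.
Let mu_ge0 : 0 <= mu. Proof. exact: ltW. Qed.

(** A gradient step of length 1/(2L) cannot go below the minimum. *)
Lemma grad_sq_le x : enorm (grad f x) ^+ 2 <= 4 * L * (f x - f xs).
Proof.
have := le_trans (ler_norm _) (first_order_bound fs fL x (- ((2 * L)^-1 *: grad f x)) s1).
rewrite innerNr innerZr -sqr_enorm enormN enormZ ger0_norm ?invr_ge0 ?mulr_ge0 //.
rewrite exprMn; move: (xs_min (x - (2 * L)^-1 *: grad f x)).
set A := f (_ - _); set g := enorm _ ^+ 2 => A1 A2.
have : (2 * L)^-1 * g <= f x - f xs + L * ((2 * L)^-1 ^+ 2 * g) by lra.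
have -> : L * ((2 * L)^-1 ^+ 2 * g) = (4 * L)^-1 * g by field; rewrite gt_eqF.
have -> : (2 * L)^-1 * g = 2 * ((4 * L)^-1 * g) by field; rewrite gt_eqF.
move=> H; rewrite -ler_pdivrMl ?mulr_gt0 //; lra.
Qed.

(** At distance 1 from the minimiser, quasi-strong convexity bounds the slope away from it
    below by mu/2, and smoothness bounds the gradient above by 2 L. *)
Lemma condition_ge : 1 / 4 <= Q.
Proof.
have g0 : grad f xs = 0.
  apply: enorm_eq0; have := grad_sq_le xs; rewrite subrr mulr0 => H.
  by apply/eqP; rewrite -sqrf_eq0 eq_le H sqr_ge0.
pose e : 'rV[R]_d := delta_mx 0 (Ordinal d1); pose x := xs + e.
have e1 : enorm e = 1.
  rewrite /enorm /inner (bigD1 (Ordinal d1)) //= big1 ?addr0 => [|i ne].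
    by rewrite !mxE !eqxx mulr1 sqrtr1.
  by rewrite !mxE (negbTE ne) andbF mulr0.
have gap : f x - f xs <= L.
  have := first_order_bound fs fL xs e s1.
  by rewrite g0 -(scale0r 0) innerZl mul0r subr0 e1 expr1n mulr1 => /(le_trans (ler_norm _)).
have g2 : enorm (grad f x) <= 2 * L.
  rewrite -(@ler_pXn2r _ 2) ?nnegrE ?enorm_ge0 ?mulr_ge0 ?L_ge0 //.
  rewrite (le_trans (grad_sq_le x)) // exprMn -mulrA.
  have -> : 2 ^+ 2 = 4 :> R by rewrite expr2; lra.
  by rewrite ler_wpM2l // expr2 ler_wpM2l //.
have x1 : xs - x = - e by rewrite /x opprD addNKr.
have x2 : x - xs = e by rewrite /x addrAC subrr add0r.
have := f_qsc x; rewrite x1 x2 innerNr e1 expr1n mulr1 => H; have := inner_le (grad f x) e; rewrite e1 mulr1 => H2.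
have H3 := xs_min x; rewrite -(ler_pM2l mu0) -QE; lra.
Qed.

Let E := lyapunov mu Q f xs.
Let F := vfield mu Q f.

Lemma lyapunov_bounds y : [/\ f (rsubmx y) - f xs <= mu * E y / 2,
  Q * enorm (lsubmx y) ^+ 2 <= 2 * E y,
  enorm (rsubmx y + rQ *: lsubmx y - xs) ^+ 2 <= 2 * E y & 0 <= E y].
Proof.
rewrite /E /lyapunov -/rQ; have A := xs_min (rsubmx y).
set B := enorm (lsubmx y) ^+ 2; set C := enorm (_ - _) ^+ 2.
have B0 : 0 <= B by apply: sqr_ge0.
have C0 : 0 <= C by apply: sqr_ge0.
have QB : 0 <= Q * B by rewrite mulr_ge0 //.
have D0 : 0 <= (f (rsubmx y) - f xs) / mu by rewrite divr_ge0 ?subr_ge0 //.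
have e : 2 * (f (rsubmx y) - f xs) / mu = 2 * ((f (rsubmx y) - f xs) / mu) by rewrite mulrA.
have e2 : Q / 2 * B = (Q * B) / 2 by rewrite mulrAC.
rewrite e e2; split; try lra.
have e3 : f (rsubmx y) - f xs = mu * ((f (rsubmx y) - f xs) / mu).
  by rewrite mulrCA divff ?mulr1 // gt_eqF.
rewrite [leLHS]e3 -mulrA ler_wpM2l //; lra.
Qed.

Lemma sqrt2_bound (u e : R) : 0 <= u -> 0 <= e -> u ^+ 2 <= 2 * e -> u <= 3 / 2 * Num.sqrt e.
Proof.
move=> u0 e0 ue; have r0 := sqrtr_ge0 e.
rewrite -(@ler_pXn2r _ 2) ?nnegrE ?mulr_ge0 //.
rewrite exprMn sqr_sqrtr // (le_trans ue) //; nra.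
Qed.

Lemma component_bounds y :
  [/\ rQ * enorm (lsubmx y) <= 3 / 2 * Num.sqrt (E y),
      (mu * rQ)^-1 * enorm (grad f (rsubmx y)) <= 3 / 2 * Num.sqrt (E y) &
      enorm (rsubmx y + rQ *: lsubmx y - xs) <= 3 / 2 * Num.sqrt (E y)].
Proof.
have [H1 H2 H3 H4] := lyapunov_bounds y; split; apply: sqrt2_bound => //.
- by rewrite mulr_ge0 ?enorm_ge0 //.
- by rewrite exprMn rQ2.
- by rewrite mulr_ge0 ?enorm_ge0 // invr_ge0 mulr_ge0 //.
- rewrite exprMn exprVn exprMn rQ2 ler_pdivrMl ?mulr_gt0 ?exprn_gt0 //.
  apply: (le_trans (grad_sq_le _)); rewrite QE.
  have -> : mu ^+ 2 * Q * (2 * E y) = 4 * (mu * Q) * (mu * E y / 2) by field.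
  by rewrite ler_wpM2l // !mulr_ge0.
- exact: enorm_ge0.
Qed.

Lemma rQ_ge : 1 / 2 <= rQ.
Proof.
rewrite -(@ler_pXn2r _ 2) ?nnegrE ?rQ_ge0 // rQ2.
have := condition_ge; lra.
Qed.

Lemma vfield_le y : enorm (F y) <= 9 * Num.sqrt (E y).
Proof.
have [H1 H2 _] := component_bounds y; have rq := rQ_ge.
rewrite (le_trans (enorm_row_mx_le _ _)) // -/rQ.
have A := enormD (- (2 *: lsubmx y)) (- ((mu * rQ)^-1 *: grad f (rsubmx y))).
rewrite !enormN !enormZ in A.
rewrite enormZ (ger0_norm rQ_ge0).
rewrite (ger0_norm (_ : 0 <= 2)) // ger0_norm in A; last by rewrite invr_ge0 mulr_ge0 //.
have w0 := enorm_ge0 (lsubmx y); nra.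
Qed.

(** The part of the vector field that is linear in the state. *)
Definition friction (z : 'rV[R]_(d + d)) : 'rV[R]_(d + d) :=
  row_mx (- (2 *: lsubmx z)) (rQ *: lsubmx z).

Lemma frictionD u v : friction (u + v) = friction u + friction v.
Proof. by rewrite /friction lsubmxD !scalerDr opprD add_row_mx. Qed.

Lemma frictionZ c u : friction (c *: u) = c *: friction u.
Proof.
rewrite /friction lsubmxZ scale_row_mx scalerN; congr row_mx; first congr (- _).
  by rewrite !scalerA mulrC.
by rewrite !scalerA mulrC.
Qed.

Lemma friction_le u : enorm (friction u) <= 5 * rQ * enorm u.
Proof.
rewrite (le_trans (enorm_row_mx_le _ _)) // enormN !enormZ.
rewrite (ger0_norm rQ_ge0) (ger0_norm (_ : 0 <= 2)) //.
have := enorm_lsubmx_le u; have := rQ_ge; have := enorm_ge0 (lsubmx u).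
by move=> H1 H2 H3; nra.
Qed.

(** The derivative of order [size us] of the vector field at [y], applied to [us]
    and divided by the factorial of its order. *)
Definition vfield_form (y : 'rV[R]_(d + d)) (us : seq 'rV[R]_(d + d)) : 'rV[R]_(d + d) :=
  ((size us)`!%:R)^-1 *:
   (row_mx (- ((mu * rQ)^-1 *: gradn f [seq rsubmx u | u <- us] (rsubmx y))) 0
    + match us with [::] => friction y | [:: u] => friction u | _ => 0 end).

Lemma vfieldE y : F y =
  row_mx (- ((mu * rQ)^-1 *: grad f (rsubmx y))) 0 + friction y.
Proof.
by rewrite /F /vfield /friction add_row_mx add0r [in RHS]addrC.
Qed.

Lemma vfield_form_nil y : vfield_form y [::] = F y.
Proof. by rewrite vfieldE /vfield_form /= fact0 invr1 scale1r. Qed.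

Lemma vfield_form_linear y us vs (c : R) u v : (size us + size vs < s)%N ->
  vfield_form y (us ++ (c *: u + v) :: vs) =
  c *: vfield_form y (us ++ u :: vs) + vfield_form y (us ++ v :: vs).
Proof.
move=> sz; have sc n (N : R) (A B : 'rV[R]_n) : c *: (N *: A) + N *: B = N *: (c *: A + B).
  by rewrite scalerDr !scalerA mulrC.
rewrite /vfield_form !size_cat /= sc; congr (_ *: _); rewrite scalerDr addrACA; congr (_ + _).
  rewrite scale_row_mx add_row_mx scaler0 addr0; congr row_mx.
  rewrite scalerN -opprD sc; congr (- (_ *: _)).
  apply/rowP => i; rewrite !mxE !map_cat /= !rcons_cat /= rsubmxD rsubmxZ.
  by rewrite (iter_derive_linear fs) // size_rcons !size_map addnS.
case: us sz => [|u1 [|u2 us]] /=; case: vs => [|v1 vs] _ /=;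
  by rewrite ?scaler0 ?addr0 // frictionD frictionZ.
Qed.

Lemma smul_rQ : (mu * rQ)^-1 * L = rQ.
Proof. by rewrite QE -rQ2; field; rewrite !gt_eqF. Qed.

Lemma prod_rsubmx_le (us : seq 'rV[R]_(d + d)) :
  \prod_(u <- [seq rsubmx u | u <- us]) enorm u <= \prod_(u <- us) enorm u.
Proof.
rewrite big_map; apply: ler_prod => u _.
by rewrite enorm_ge0 enorm_rsubmx_le.
Qed.

Lemma vfield_form_le y us : (1 <= size us < s)%N ->
  enorm (vfield_form y us) <= 6 * rQ * \prod_(u <- us) enorm u.
Proof.
move=> /andP[sz1 sz2]; rewrite enormZ.
have P0 : 0 <= \prod_(u <- us) enorm u by apply: prodr_ge0 => u _; apply: enorm_ge0.
have f1 : `|(size us)`!%:R^-1| <= 1 :> R.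
  by rewrite ger0_norm ?invr_ge0 // invf_le1 ?ler1n ?ltr0n ?fact_gt0.
apply: (le_trans (ler_wpM2r (enorm_ge0 _) f1)); rewrite mul1r.
apply: (le_trans (enormD _ _)).
have A : enorm (row_mx (- ((mu * rQ)^-1 *: gradn f [seq rsubmx u | u <- us] (rsubmx y)))
    (0 : 'rV[R]_d)) <= rQ * \prod_(u <- us) enorm u.
  rewrite (le_trans (enorm_row_mx_le _ _)) // enorm0 addr0 enormN enormZ.
  have i0 : 0 <= (mu * rQ)^-1 by rewrite invr_ge0 mulr_ge0 //.
  rewrite ger0_norm // -[in leRHS]smul_rQ -mulrA ler_wpM2l //.
  have szm : (1 <= size [seq rsubmx u | u <- us] <= s)%N by rewrite size_map sz1 ltnW.
  rewrite (le_trans (enorm_gradn_le fs fL _ L_ge0 szm)) //.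
  by rewrite ler_wpM2l ?prod_rsubmx_le //.
suff B : enorm (match us with [::] => friction y | [:: u] => friction u | _ => 0 end)
    <= 5 * rQ * \prod_(u <- us) enorm u by lra.
case: us {A f1 sz2} sz1 P0 => [//|u [|v us]] _ P0; last first.
  by rewrite enorm0 !mulr_ge0 //.
by rewrite big_seq1 friction_le.
Qed.

Lemma vfield_taylor y u :
  enorm (F (y + u) - \sum_(k < s) vfield_form y (nseq k u)) <= 6 * rQ * enorm u ^+ s.
Proof.
have eu := enorm_ge0 u.
have -> : F (y + u) - \sum_(k < s) vfield_form y (nseq k u) =
  row_mx (- ((mu * rQ)^-1 *: (grad f (rsubmx y + rsubmx u) -
     \sum_(k < s) (k`!%:R)^-1 *: gradn f (nseq k (rsubmx u)) (rsubmx y)))) 0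
  + (if s == 1%N then friction u else 0).
  have -> : \sum_(k < s) vfield_form y (nseq k u) =
    row_mx (- ((mu * rQ)^-1 *: \sum_(k < s) (k`!%:R)^-1 *: gradn f (nseq k (rsubmx u)) (rsubmx y))) 0
    + (if s == 1%N then friction y else friction (y + u)).
    under eq_bigr do rewrite /vfield_form scalerDr size_nseq map_nseq.
    rewrite big_split /=; congr (_ + _).
      rewrite scaler_sumr -sumrN.
      have rm (A B : 'rV[R]_d) : row_mx (A + B) 0 = row_mx A (0 : 'rV[R]_d) + row_mx B 0.
        by rewrite add_row_mx addr0.
      rewrite (big_morph (fun A => row_mx A (0 : 'rV[R]_d)) rm (row_mx0 _ _ _ _)).
      apply: eq_bigr => k _; rewrite scale_row_mx scaler0 scalerN; congr (row_mx (- _) _).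
      by rewrite !scalerA mulrC.
    case: s s1 => [//|[|n]] _ /=.
      by rewrite big_ord1 /= fact0 invr1 scale1r.
    rewrite !big_ord_recl /= fact0 invr1 !scale1r big1 ?addr0 => [|k _].
      by rewrite frictionD.
    by rewrite scaler0.
  have rmB (g h : 'rV[R]_d) : row_mx (- ((mu * rQ)^-1 *: (g - h))) (0 : 'rV[R]_d) =
      row_mx (- ((mu * rQ)^-1 *: g)) 0 - row_mx (- ((mu * rQ)^-1 *: h)) 0.
    by rewrite opp_row_mx add_row_mx opprK oppr0 addr0 scalerBr opprB addrC.
  rewrite vfieldE rsubmxD rmB.
  move: (row_mx _ _) (row_mx _ _) => A B.
  by case: ifP => _; rewrite ?frictionD; apply/rowP => i; rewrite !mxE; ring.
apply: (le_trans (enormD _ _)).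
have A : enorm (row_mx (- ((mu * rQ)^-1 *: (grad f (rsubmx y + rsubmx u) -
     \sum_(k < s) (k`!%:R)^-1 *: gradn f (nseq k (rsubmx u)) (rsubmx y)))) (0 : 'rV[R]_d))
     <= rQ * enorm u ^+ s.
  rewrite (le_trans (enorm_row_mx_le _ _)) // enorm0 addr0 enormN enormZ.
  have i0 : 0 <= (mu * rQ)^-1 by rewrite invr_ge0 mulr_ge0 //.
  rewrite ger0_norm // -[in leRHS]smul_rQ -mulrA ler_wpM2l //.
  rewrite (le_trans (grad_taylor fs fL _ _ L_ge0 s1)) // ler_wpM2l ?L_ge0 //.
  by rewrite lerXn2r ?nnegrE ?enorm_ge0 // enorm_rsubmx_le.
suff B : enorm (if s == 1%N then friction u else 0) <= 5 * rQ * enorm u ^+ s by lra.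
case: eqP => [->|_]; first exact: friction_le.
by rewrite enorm0 !mulr_ge0 ?exprn_ge0 //.
Qed.

(** * The Lyapunov function along the flow *)

(** The differential of the Lyapunov function at [y]. *)
Definition dlyapunov (y v : 'rV[R]_(d + d)) : R :=
  2 / mu * inner (grad f (rsubmx y)) (rsubmx v) + Q * inner (lsubmx y) (lsubmx v)
  + inner (rsubmx y + rQ *: lsubmx y - xs) (rsubmx v + rQ *: lsubmx v).

Let mix_le (v : 'rV[R]_(d + d)) : enorm (rsubmx v + rQ *: lsubmx v) <= 3 * rQ * enorm v.
Proof.
rewrite (le_trans (enormD _ _)) // enormZ (ger0_norm rQ_ge0).
have := enorm_lsubmx_le v; have := enorm_rsubmx_le v; have := rQ_ge.
have := enorm_ge0 v; have := enorm_ge0 (lsubmx v); move: rQ0 => *; nra.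
Qed.

Lemma dlyapunov_le y v : dlyapunov y v <= 9 * rQ * Num.sqrt (E y) * enorm v.
Proof.
have [H1 H2 H3] := component_bounds y; have v0 := enorm_ge0 v.
have B1 := inner_le (grad f (rsubmx y)) (rsubmx v).
have B2 := inner_le (lsubmx y) (lsubmx v).
have B3 := inner_le (rsubmx y + rQ *: lsubmx y - xs) (rsubmx v + rQ *: lsubmx v).
have r0 := sqrtr_ge0 (E y).
have T1 : 2 / mu * inner (grad f (rsubmx y)) (rsubmx v) <= 3 * rQ * Num.sqrt (E y) * enorm v.
  have -> : 2 / mu = 2 * rQ * (mu * rQ)^-1 by field; rewrite !gt_eqF.
  rewrite -!mulrA; apply: (@le_trans _ _ (2 * (rQ * ((mu * rQ)^-1 * (enorm (grad f (rsubmx y)) * enorm v))))).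
    rewrite ler_wpM2l // ler_wpM2l // ler_wpM2l ?invr_ge0 ?mulr_ge0 // (le_trans B1) //.
    by rewrite ler_wpM2l ?enorm_ge0 ?enorm_rsubmx_le.
  have A := ler_wpM2r (mulr_ge0 rQ_ge0 v0) H2.
  by lra.
have T2 : Q * inner (lsubmx y) (lsubmx v) <= 3 / 2 * rQ * Num.sqrt (E y) * enorm v.
  apply: (@le_trans _ _ (Q * (enorm (lsubmx y) * enorm v))).
    rewrite ler_wpM2l // (le_trans B2) //.
    by rewrite ler_wpM2l ?enorm_ge0 ?enorm_lsubmx_le.
  rewrite -rQ2; have A := ler_wpM2r (mulr_ge0 rQ_ge0 v0) H1.
  by lra.
have T3 : inner (rsubmx y + rQ *: lsubmx y - xs) (rsubmx v + rQ *: lsubmx v)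
    <= 9 / 2 * rQ * Num.sqrt (E y) * enorm v.
  apply: (le_trans B3); apply: (le_trans (ler_pM (enorm_ge0 _) (enorm_ge0 _) H3 (mix_le v))).
  by lra.
rewrite /dlyapunov; lra.
Qed.

(** The cross terms cancel along the flow, and quasi-strong convexity turns the
    remaining pairing of the gradient into the energy itself. *)
Lemma dlyapunov_vfield y : dlyapunov y (F y) <= - (1 / 2) * E y.
Proof.
have e1 : lsubmx (F y) = - (2 *: lsubmx y) - (mu * rQ)^-1 *: grad f (rsubmx y).
  by rewrite /F /vfield row_mxKl.
have e2 : rsubmx (F y) = rQ *: lsubmx y by rewrite /F /vfield row_mxKr.
have H := f_qsc (rsubmx y).
rewrite /dlyapunov /E /lyapunov e1 e2 -/rQ.
set w := lsubmx y; set x := rsubmx y in H *; set g := grad f x in H *.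
have -> : x + rQ *: w - xs = (x - xs) + rQ *: w by rewrite addrAC.
have exz : xs - x = - (x - xs) by rewrite opprB.
rewrite {}exz in H; move: (x - xs) H => z H.
have Z0 := inner_ge0 (z + rQ *: w); have W0 := inner_ge0 w.
rewrite sqr_enorm innerNr in H; rewrite !sqr_enorm.
rewrite !(innerDl, innerDr, innerZl, innerZr, innerNl, innerNr) (innerC w z) in Z0.
rewrite !(innerDl, innerDr, innerZl, innerZr, innerNl, innerNr).
rewrite (innerC w z) (innerC w g) (innerC z g).
move: (inner g w) (inner g z) (inner z w) (inner w w) (inner z z) H Z0 W0.
move=> gw gz zw ww zz H Z0 W0; set l := (X in X <= _).
have -> : l = - 3 * rQ ^+ 2 * ww - rQ * zw - gz / mu.
  by rewrite /l -rQ2; field; rewrite !gt_eqF.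
have H2 : (f x - f xs) / mu - gz / mu <= - (1 / 2) * zz.
  by rewrite -mulrBl ler_pdivrMr //; lra.
have QW : 0 <= rQ * (rQ * ww) by rewrite !mulr_ge0.
rewrite -rQ2 expr2; lra.
Qed.

Lemma dlyapunovN y v : dlyapunov y (- v) = - dlyapunov y v.
Proof.
rewrite /dlyapunov (_ : rsubmx (- v) = - rsubmx v); last by apply/rowP => i; rewrite !mxE.
rewrite (_ : lsubmx (- v) = - lsubmx v); last by apply/rowP => i; rewrite !mxE.
by rewrite scalerN -opprD !innerNr; ring.
Qed.

(** Only the objective contributes more than a quadratic term, and its remainder of first
    order is bounded by smoothness. *)
Lemma lyapunov_expand y v :
  `|E (y + v) - E y - dlyapunov y v| <= 7 * Q * enorm v ^+ 2.
Proof.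
have H := first_order_bound fs fL (rsubmx y) (rsubmx v) s1.
rewrite /E /lyapunov -/rQ /dlyapunov rsubmxD lsubmxD.
have -> : rsubmx y + rsubmx v + rQ *: (lsubmx y + lsubmx v) - xs =
   (rsubmx y + rQ *: lsubmx y - xs) + (rsubmx v + rQ *: lsubmx v).
  by apply/rowP => i; rewrite !mxE; ring.
have M1 := mix_le v; have M2 := enorm_lsubmx_le v; have M3 := enorm_rsubmx_le v.
set c := rsubmx v + _ in M1 *; set z := rsubmx y + _ - _.
have sqD m (u1 u2 : 'rV[R]_m) : inner (u1 + u2) (u1 + u2) = inner u1 u1 + 2 * inner u1 u2 + inner u2 u2.
  by rewrite innerDl !innerDr (innerC u2 u1); ring.
rewrite (sqr_enorm (z + c)) (sqr_enorm z) (sqr_enorm (lsubmx y + _)) (sqr_enorm (lsubmx y)).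
rewrite (sqD _ z c) (sqD _ (lsubmx y)).
have c2 : inner c c <= 9 * Q * enorm v ^+ 2.
  rewrite -sqr_enorm -rQ2 (_ : 9 * rQ ^+ 2 * _ = (3 * rQ * enorm v) ^+ 2); last by ring.
  by rewrite lerXn2r ?nnegrE ?enorm_ge0 // !mulr_ge0 ?enorm_ge0.
have w2 : inner (lsubmx v) (lsubmx v) <= enorm v ^+ 2.
  by rewrite -sqr_enorm lerXn2r ?nnegrE ?enorm_ge0.
have x2 : enorm (rsubmx v) ^+ 2 <= enorm v ^+ 2.
  by rewrite lerXn2r ?nnegrE ?enorm_ge0.
set r := f _ - f _ - _ in H.
have r2 : `|2 / mu * r| <= 2 * Q * enorm v ^+ 2.
  rewrite normrM ger0_norm ?divr_ge0 //.
  have -> : 2 * Q * enorm v ^+ 2 = 2 / mu * (L * enorm v ^+ 2).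
    by rewrite QE; field; rewrite gt_eqF.
  by rewrite ler_wpM2l ?divr_ge0 // (le_trans H) // ler_wpM2l.
have qw := ler_wpM2l Q_ge0 w2; have qw0 := mulr_ge0 Q_ge0 (inner_ge0 (lsubmx v)).
have c0 := inner_ge0 c.
rewrite [X in `|X|](_ : _ = 2 / mu * r + (Q * inner (lsubmx v) (lsubmx v)) / 2 + inner c c / 2).
  rewrite (le_trans (ler_normD _ _)) // (ger0_norm (_ : 0 <= inner c c / 2)) ?divr_ge0 //.
  have := ler_normD (2 / mu * r) (Q * inner (lsubmx v) (lsubmx v) / 2).
  rewrite (ger0_norm (_ : 0 <= Q * inner (lsubmx v) (lsubmx v) / 2)) ?divr_ge0 //.
  by lra.
by rewrite /r; field; rewrite gt_eqF.
Qed.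

Lemma lyapunov_lipschitz y v :
  `|E (y + v) - E y| <= 9 * rQ * Num.sqrt (E y) * enorm v + 7 * Q * enorm v ^+ 2.
Proof.
have H1 := dlyapunov_le y v; have := dlyapunov_le y (- v); rewrite dlyapunovN enormN => H2.
rewrite -[X in `|X|](subrK (dlyapunov y v)) (le_trans (ler_normD _ _)) // addrC.
by rewrite lerD ?lyapunov_expand // ler_norml H1 andbT lerNl.
Qed.

Lemma is_derive_lyapunov (p : R -> 'rV[R]_(d + d)) (t : R) dp :
  is_derive t (1 : R) p dp -> is_derive t (1 : R) (fun x => E (p x)) (dlyapunov (p t) dp).
Proof.
move=> pd; have dr := is_derive_rsubmx pd; have dl := is_derive_lsubmx pd.
have fd : is_derive t (1 : R) (fun x => f (rsubmx (p x))) (inner (grad f (rsubmx (p t))) (rsubmx dp)).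
  rewrite (inner_grad fs); apply: (is_derive_comp_curve dr).
  exact: (fs (us := [::])).
have md : is_derive t (1 : R) (fun x => rsubmx (p x) + rQ *: lsubmx (p x) - xs)
    (rsubmx dp + rQ *: lsubmx dp).
  have := is_deriveB (is_deriveD dr (is_deriveZ rQ dl)) (is_derive_cst xs t 1).
  by rewrite subr0.
have H := is_deriveD (is_deriveD (is_deriveZ (2 / mu) (is_deriveB fd (is_derive_cst (f xs) t 1)))
  (is_deriveZ (Q / 2) (is_derive_sqr_enorm dl))) (is_deriveZ (1 / 2) (is_derive_sqr_enorm md)).
have -> : (fun x => E (p x)) =
    ((2 / mu) \*: ((fun x => f (rsubmx (p x))) - cst (f xs)))
    + ((Q / 2) \*: (fun x => enorm (lsubmx (p x)) ^+ 2))
    + ((1 / 2) \*: (fun x => enorm (rsubmx (p x) + rQ *: lsubmx (p x) - xs) ^+ 2)).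
  apply/funext => x; rewrite /E /lyapunov -/rQ mulrAC.
  by [].
apply: is_derive_eq H _; rewrite /dlyapunov /GRing.scale /= subr0.
move: (inner _ _) (inner _ _) (inner _ _) => u1 u2 u3.
by field; rewrite gt_eqF.
Qed.

Lemma dlyapunovD y u v : dlyapunov y (u + v) = dlyapunov y u + dlyapunov y v.
Proof.
by rewrite /dlyapunov rsubmxD lsubmxD scalerDr addrACA !innerDr; ring.
Qed.

(** * One step of the integrator *)

Section one_step.
Variables (y : 'rV[R]_(d + d)).
Hypothesis Ey0 : 0 < E y.

(** The unit of length. Being at most 1, it makes the rescaled derivatives of order at
    least two no larger than the first one; being at most sqrt(E/Q), it bounds energy
    variations by E; and it is large enough for [MsigmaE] below, which says that the
    rescaled field itself is bounded by 1. *)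
Let sigma := Num.min (Num.sqrt (E y) / rQ) 1.
(** The inverse of the unit of time. *)
Let M := 9 * Num.sqrt (Num.max (E y) Q).

Let sE0 : 0 < Num.sqrt (E y). Proof. by rewrite sqrtr_gt0. Qed.
Let sigma0 : 0 < sigma. Proof. by rewrite lt_min ltr01 divr_gt0. Qed.
Let sigma1 : sigma <= 1. Proof. by rewrite ge_min lexx orbT. Qed.
Let sigmaE : rQ * sigma <= Num.sqrt (E y).
Proof. by rewrite mulrC -ler_pdivlMr // ge_min lexx. Qed.
Let M0 : 0 < M. Proof. by rewrite mulr_gt0 // sqrtr_gt0 lt_max Q0 orbT. Qed.
Let MrQ : 9 * rQ <= M.
Proof. by rewrite ler_wpM2l // ler_wsqrtr // le_max lexx orbT. Qed.
Let MsigmaE : 9 * Num.sqrt (E y) <= M * sigma.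
Proof.
rewrite /M -mulrA ler_wpM2l //; rewrite /sigma; set m := Num.max _ _.
have mE : E y <= m by rewrite le_max lexx.
have mQ : Q <= m by rewrite le_max lexx orbT.
rewrite minr_pMr ?sqrtr_ge0 // mulr1 le_min (ler_wsqrtr mE) andbT.
rewrite mulrCA -[leLHS]mulr1 ler_wpM2l ?sqrtr_ge0 //.
by rewrite ler_pdivlMr // mul1r ler_wsqrtr.
Qed.

Let nrm (u : 'rV[R]_(d + d)) : R := enorm u / sigma.
Let form us := if (size us < s)%N then M^-1 *: vfield_form y us else 0.
Let field u := M^-1 *: F (y + u).

Let nrmD u v : nrm (u + v) <= nrm u + nrm v.
Proof. by rewrite -mulrDl ler_wpM2r ?enormD // invr_ge0 ltW. Qed.

Let nrmZ (c : R) u : nrm (c *: u) = `|c| * nrm u.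
Proof. by rewrite /nrm enormZ mulrA. Qed.

Let form_linear us vs (c : R) u v : form (us ++ (c *: u + v) :: vs) =
  c *: form (us ++ u :: vs) + form (us ++ v :: vs).
Proof.
rewrite /form !size_cat /=; case: ifP => sz; last by rewrite scaler0 addr0.
rewrite vfield_form_linear; last by rewrite -addnS ltnW.
by rewrite scalerDr !scalerA (mulrC M^-1).
Qed.

Let form_le us : nrm (form us) <= \prod_(u <- us) nrm u.
Proof.
have P0 (ws : seq 'rV[R]_(d + d)) : 0 <= \prod_(u <- ws) enorm u.
  by apply: prodr_ge0 => u _; apply: enorm_ge0.
have is0 : 0 <= sigma^-1 by rewrite invr_ge0 ltW.
have P1 (ws : seq 'rV[R]_(d + d)) : \prod_(u <- ws) enorm u <= \prod_(u <- ws) nrm u.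
  apply: ler_prod => u _; rewrite enorm_ge0 ler_pdivlMr //.
  by rewrite ler_piMr ?enorm_ge0.
rewrite /form; case: ifP => sz; last first.
  by rewrite /nrm enorm0 mul0r (le_trans (P0 us)).
rewrite /nrm enormZ ger0_norm ?invr_ge0 ?(ltW M0) //.
rewrite ler_pdivrMr // ler_pdivrMl //.
case: us sz => [|u us] sz.
  by rewrite big_nil mul1r vfield_form_nil (le_trans (vfield_le _)).
rewrite (le_trans (vfield_form_le _ _)) // !big_cons /nrm -/(nrm _).
have -> : M * (enorm u / sigma * \prod_(v <- us) nrm v * sigma) =
  M * enorm u * \prod_(v <- us) nrm v by field; rewrite gt_eqF.
rewrite mulrA; apply: ler_pM; rewrite ?mulr_ge0 ?enorm_ge0 ?P0 ?P1 //.
rewrite ler_wpM2r ?enorm_ge0 //; move: MrQ rQ0; lra.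
Qed.

Let field_taylor u :
  nrm (field u - \sum_(k < s) form (nseq k u)) <= nrm u ^+ s.
Proof.
have -> : field u - \sum_(k < s) form (nseq k u) =
  M^-1 *: (F (y + u) - \sum_(k < s) vfield_form y (nseq k u)).
  rewrite scalerBr scaler_sumr; congr (_ - _); apply: eq_bigr => k _.
  by rewrite /form size_nseq ltn_ord.
rewrite nrmZ ger0_norm ?invr_ge0 ?(ltW M0) // ler_pdivrMl // ler_pdivrMr //.
apply: (le_trans (vfield_taylor _ _)); rewrite /nrm expr_div_n.
case: s s1 => [//|n] _; rewrite [sigma ^+ _]exprSr.
have sn : 0 < sigma ^+ n by rewrite exprn_gt0.
have -> : M * (enorm u ^+ n.+1 / (sigma ^+ n * sigma)) * sigma = M / sigma ^+ n * enorm u ^+ n.+1.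
  by field; rewrite !gt_eqF.
rewrite ler_wpM2r ?exprn_ge0 ?enorm_ge0 // ler_pdivlMr //.
have sn1 : sigma ^+ n <= 1 by rewrite exprn_ile1 // ltW.
by apply: (@le_trans _ _ (6 * rQ)); [rewrite ler_piMr // mulr_ge0|move: MrQ rQ0; lra].
Qed.

Definition vfield_jet : jet R s := Jet nrmD nrmZ form_linear form_le field_taylor.

Variables (S : nat) (a : 'M[R]_S) (b : 'rV[R]_S) (C h : R).
Hypothesis C0 : 0 <= C.
Hypothesis small_local_error : local_error_bound s a b C.
Hypotheses (h0 : 0 < h) (h1 : 64 * (1 + C) ^+ 2 * (M * h) <= 1)
  (h2 : 288 * (1 + C) ^+ 2 * (M * (M * h) ^+ s) <= 1).

Let jet_curve : exists q q1 : R -> 'rV[R]_(d + d),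
  [/\ q 0 = 0, forall t, is_derive (t : R) (1 : R) q (q1 t) &
    forall t, 0 <= t <= 1 -> [/\ rQ * enorm (q t) <= Num.sqrt (E y) * (C * t),
      rQ * enorm (q1 t - M^-1 *: F (y + q t)) <= Num.sqrt (E y) * (C * t ^+ s) &
      rQ * enorm (rk_step a b field t 0 - q t) <= Num.sqrt (E y) * (C * t ^+ s.+1)]].
Proof.
have [q [q1 [q0 dq LE]]] := small_local_error vfield_jet.
exists q, q1; split=> // t t01.
have unscale (u : 'rV[R]_(d + d)) (B : R) : 0 <= B -> nrm u <= B -> rQ * enorm u <= Num.sqrt (E y) * B.
  move=> B0; rewrite ler_pdivrMr // => uB.
  apply: (le_trans (ler_wpM2l rQ_ge0 uB)).
  by rewrite mulrCA mulrC ler_wpM2r.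
have [L1 L2 L3] := LE t t01; have /andP[t0 _] := t01.
by split; apply: unscale; rewrite ?mulr_ge0 ?exprn_ge0.
Qed.

(** With th = M h, the curve stays within O(th sigma) of [y], so the energy on it is
    E(y) up to a factor 1 + O(th). Its derivative is at most - E/2, plus the defect of the
    curve, which costs E M th^s; the distance from the end of the curve to the numerical
    step costs as much, multiplied by h. The two smallness hypotheses absorb these terms
    in half of the gain h E / 2. *)
Lemma lyapunov_step : E (rk_step a b F h y) <= (1 - h / 4) * E y.
Proof.
have [q [q1 [q0 dq LE]]] := jet_curve.
have k1 := h1; have k2 := h2.
set A := (1 + C) ^+ 2 in k1 k2; set th := M * h in k1 k2; set Y := M * th ^+ s in k2.
set e := Num.sqrt (E y) in LE.
have e0 : 0 <= e by apply: sqrtr_ge0.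
have e2 : e * e = E y by rewrite -expr2 sqr_sqrtr // ltW.
have th0 : 0 < th by rewrite mulr_gt0.
have th0' : 0 <= th by apply: ltW.
have M0' : 0 <= M by apply: ltW.
have h0' : 0 <= h by apply: ltW.
have Ey0' : 0 <= E y by apply: ltW.
have [A1 CA C2A CA36] := sqr1D_ge C0; rewrite -/A in A1 CA C2A CA36.
have Ath : th <= A * th by rewrite ler_peMl // ltW.
have th1 : th <= 1 by lra.
have ths0 : 0 <= th ^+ s by rewrite exprn_ge0 // ltW.
have ths1 : th ^+ s <= 1 by rewrite exprn_ile1 // ltW.
have Y0 : 0 <= Y by rewrite mulr_ge0 // ltW.
pose p t := y + q (M * t).
have scaled t : 0 <= t <= h -> 0 <= M * t <= th.
  by move=> /andP[t0 th']; rewrite mulr_ge0 ?(ltW M0) // ler_wpM2l // ltW.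
have unit t : 0 <= t <= h -> 0 <= M * t <= 1.
  by move=> /scaled /andP[-> /le_trans ->].
(* The energy hardly varies along the curve. *)
have near_y t : 0 <= t <= h -> `|E (p t) - E y| <= 16 * (A * th) * E y.
  move=> tb; have [L1 _ _] := LE _ (unit _ tb); have /andP[_ tth] := scaled _ tb.
  rewrite (le_trans (lyapunov_lipschitz _ _)) // -rQ2.
  set n := enorm _ in L1 *; have n0 : 0 <= rQ * n by rewrite mulr_ge0 ?enorm_ge0.
  have L4 : rQ * n <= e * (C * th) by rewrite (le_trans L1) // ler_wpM2l // ler_wpM2l.
  have L5 : (rQ * n) * (rQ * n) <= E y * (C * C * (th * th)).
    by apply: (le_trans (ler_pM n0 n0 L4 L4)); rewrite -e2 (_ : e * (C * th) * (e * (C * th)) = e * e * (C * C * (th * th))) //; ring.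
  have L6 : e * (rQ * n) <= E y * (C * th).
    by rewrite -e2 -mulrA ler_wpM2l.
  have L7 : C * C * (th * th) <= A * th.
    apply: ler_pM => //; [exact: mulr_ge0|exact: mulr_ge0|exact: ler_piMl].
  have L8 : C * th <= A * th by rewrite ler_wpM2r // ltW.
  have L9 := ler_wpM2l (ltW Ey0) L7; have L10 := ler_wpM2l (ltW Ey0) L8.
  have -> : 9 * rQ * Num.sqrt (E y) * n + 7 * rQ ^+ 2 * n ^+ 2 =
     9 * (e * (rQ * n)) + 7 * ((rQ * n) * (rQ * n)) by rewrite /e; ring.
  by lra.
have sqrt_near t : 0 <= t <= h -> Num.sqrt (E (p t)) <= 2 * e.
  move=> /near_y; rewrite ler_norml => /andP[_ H].
  rewrite -(@ger0_norm _ 2) // -sqrtr_sqr -sqrtrM ?sqr_ge0 // ler_wsqrtr //.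
  by apply: (energy_growth_arith _ Ey0' H); rewrite mulrA.
have pd t : is_derive (t : R) (1 : R) p (M *: q1 (M * t)).
  have dqM : differentiable q (M * t) by apply/derivable1_diffP; apply: ex_derive.
  have dM : is_derive t (1 : R) (fun x => M * x) M.
    by apply: is_derive_eq (is_deriveZ M (is_derive_id t 1)) _; rewrite /GRing.scale /= mulr1.
  have := is_deriveD (is_derive_cst y t 1) (is_derive_comp_curve dM dqM).
  rewrite add0r deriveE // -[X in 'd q _ X]mulr1 -[M * 1]/(M *: 1) linearZ -deriveE //.
  by rewrite (@derive_val _ _ _ _ _ _ _ (dq (M * t))).
have Ed t : is_derive (t : R) (1 : R) (fun x => E (p x)) (dlyapunov (p t) (M *: q1 (M * t))).
  exact: is_derive_lyapunov (pd t).
(* Decay along the field, plus the cost of the defect of the curve. *)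
have rate t : 0 <= t <= h ->
    dlyapunov (p t) (M *: q1 (M * t)) <= E y * (- (1 / 2) + 8 * (A * th) + 18 * (C * Y)).
  move=> tb; have [_ L1 _] := LE _ (unit _ tb); have /andP[tm tth] := scaled _ tb.
  rewrite -[q1 _](subrK (M^-1 *: F (p t))) scalerDr scalerA divff ?gt_eqF // scale1r dlyapunovD.
  have B1 := dlyapunov_vfield (p t).
  have B2 := dlyapunov_le (p t) (M *: (q1 (M * t) - M^-1 *: F (p t))).
  have B3 : 9 * rQ * Num.sqrt (E (p t)) * enorm (M *: (q1 (M * t) - M^-1 *: F (p t)))
      <= 18 * (C * Y) * E y.
    rewrite enormZ (ger0_norm (ltW M0)).
    have -> (u v : R) : 9 * rQ * u * (M * v) = 9 * (u * (M * (rQ * v))) by ring.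
    have B4 : (M * t) ^+ s <= th ^+ s by rewrite lerXn2r ?nnegrE // ltW.
    have B5 : M * (rQ * enorm (q1 (M * t) - M^-1 *: F (p t))) <= e * (C * Y).
      rewrite /Y (_ : e * (C * (M * th ^+ s)) = M * (e * (C * th ^+ s))); last by ring.
      rewrite ler_wpM2l ?(ltW M0) // (le_trans L1) //.
      by rewrite ler_wpM2l // ler_wpM2l.
    have B6 : 0 <= M * (rQ * enorm (q1 (M * t) - M^-1 *: F (p t))).
      by rewrite !mulr_ge0 ?enorm_ge0 ?(ltW M0).
    have -> : 18 * (C * Y) * E y = 9 * (2 * e * (e * (C * Y))) by rewrite -e2; ring.
    by rewrite ler_wpM2l // ler_pM ?sqrtr_ge0 // sqrt_near.
  have := near_y _ tb; rewrite ler_norml => /andP[B7 _].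
  rewrite [leLHS]addrC; exact: (energy_rate_arith B1 B2 B3 B7).
have Eph : E (p h) <= E y + h * (E y * (- (1 / 2) + 8 * (A * th) + 18 * (C * Y))).
  have hc : {within `[0, h], continuous (fun x => E (p x))}.
    by apply: derivable_within_continuous => x _; apply: ex_derive.
  have [x xin] := @MVT_segment R _ _ 0 h (ltW h0) (fun x _ => Ed x) hc.
  rewrite subr0 /p mulr0 q0 addr0 -/p => H.
  by rewrite -lerBlDl H mulrC ler_wpM2l // rate.
have hh : 0 <= h <= h by rewrite lexx ltW.
have [_ _ L3] := LE _ (unit _ hh).
pose v := rk_step a b field (M * h) 0 - q (M * h).
have stepE : rk_step a b F h y = p h + v.
  rewrite (@rk_step_rescale _ _ a b _ F h M y) ?gt_eqF // -/field /p /v.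
  by rewrite -addrA [q _ + _]addrC subrK.
have := lyapunov_lipschitz (p h) v; rewrite -stepE -rQ2 => /(le_trans (ler_norm _)) Hlip.
have V0 : 0 <= rQ * enorm v by rewrite mulr_ge0 ?enorm_ge0.
(* One factor M h of the local error supplies the factor h of the gain. *)
have thS : th ^+ s.+1 = h * Y by rewrite exprSr /Y {2}/th; ring.
rewrite -/v -/th thS in L3.
have hY0 : 0 <= h * Y by rewrite mulr_ge0 // ltW.
have hY1 : h * Y <= 1 by rewrite -thS exprn_ile1 // ltW.
have V1 := ler_pM (sqrtr_ge0 _) V0 (sqrt_near _ hh) L3.
have V2 : (rQ * enorm v) * (rQ * enorm v) <= E y * (C * C * (h * Y)).
  apply: (le_trans (ler_pM V0 V0 L3 L3)).
  have -> : e * (C * (h * Y)) * (e * (C * (h * Y))) = E y * (C * C * ((h * Y) * (h * Y))).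
    by rewrite -e2; ring.
  rewrite ler_wpM2l ?(ltW Ey0) // ler_wpM2l ?mulr_ge0 // ler_piMl //.
have H2 : E (rk_step a b F h y) - E (p h) <= h * (E y * (18 * (C * Y) + 7 * (C * C * Y))).
  apply: (le_trans Hlip).
  have -> : 9 * rQ * Num.sqrt (E (p h)) * enorm v + 7 * rQ ^+ 2 * enorm v ^+ 2 =
    9 * (Num.sqrt (E (p h)) * (rQ * enorm v)) + 7 * ((rQ * enorm v) * (rQ * enorm v)) by ring.
  have -> : h * (E y * (18 * (C * Y) + 7 * (C * C * Y))) =
    9 * (2 * e * (e * (C * (h * Y)))) + 7 * (E y * (C * C * (h * Y))) by rewrite -e2; ring.
  by rewrite lerD // ler_wpM2l.
apply: (energy_budget_arith h0' Ey0' Y0 CA36 _ k2 Eph H2).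
by rewrite mulrA.
Qed.

End one_step.

(** * Iterates *)

Section iterates.
Variables (S : nat) (a : 'M[R]_S) (b : 'rV[R]_S) (C : R).
Hypothesis C0 : 0 <= C.
Hypothesis small_local_error : local_error_bound s a b C.

Let A := (1 + C) ^+ 2.
Let A1 : 1 <= A. Proof. by rewrite exprn_ege1 // lerDl. Qed.

Let Lam0 y : 1 / 4 <= Num.max (E y) Q.
Proof. by rewrite le_max condition_ge orbT. Qed.

(** A zero of the energy is an equilibrium, hence a fixed point of the method; this is the
    case in which space cannot be rescaled. *)
Lemma lyapunov_decrease y h : 0 < h ->
  h * Num.max (E y) Q `^ rate_exponent s <= step_scale s A ->
  E (rk_step a b F h y) <= (1 - h / 4) * E y.
Proof.
move=> h0 hL; have [_ _ _ Ege] := lyapunov_bounds y.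
have [E00|E1] := eqVneq (E y) 0.
  have F0 : F y = 0.
    apply: enorm_eq0; apply/eqP; rewrite eq_le enorm_ge0 andbT.
    by have := vfield_le y; rewrite E00 sqrtr0 mulr0.
  by rewrite rk_step_fixed // E00 mulr0.
have Ep : 0 < E y by rewrite lt_neqAle eq_sym E1.
have [B1 B2] := step_size_small s1 A1 (Lam0 y) h0 hL.
exact: (lyapunov_step Ep C0 small_local_error h0 B1 B2).
Qed.

Lemma step_lt4 y h : 0 < h -> h * Num.max (E y) Q `^ rate_exponent s <= step_scale s A ->
  0 <= 1 - h / 4 <= 1.
Proof.
move=> h0 hL; have [B1 _] := step_size_small s1 A1 (Lam0 y) h0 hL.
have r2 : 1 / 2 <= Num.sqrt (Num.max (E y) Q).
  rewrite (le_trans rQ_ge) // ler_wsqrtr // le_max lexx orbT //.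
have B2 : 9 * (1 / 2) * h <= 9 * Num.sqrt (Num.max (E y) Q) * h.
  by rewrite ler_wpM2r ?(ltW h0) // ler_wpM2l.
set z := 9 * Num.sqrt (Num.max (E y) Q) * h in B1 B2.
have z0 : 0 <= z by apply: le_trans B2; rewrite !mulr_ge0 // ltW.
by apply: (small_step_arith h0 B2 _ B1); rewrite ler_peMl.
Qed.

Lemma lyapunov_iterates y0 h : 0 < h ->
  h * Num.max (E y0) Q `^ rate_exponent s <= step_scale s A ->
  forall N, E (rk_iter a b F h y0 N) <= (1 - h / 4) ^+ N * E y0.
Proof.
move=> h0 hL; have /andP[r0 r1] := step_lt4 h0 hL.
have [_ _ _ E0] := lyapunov_bounds y0.
elim=> [|N IH]; first by rewrite mul1r.
have EN : E (rk_iter a b F h y0 N) <= E y0.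
  by rewrite (le_trans IH) // ler_piMl // exprn_ile1.
have hN : h * Num.max (E (rk_iter a b F h y0 N)) Q `^ rate_exponent s <= step_scale s A.
  exact: (step_size_mono (ltW h0) Q_ge0 EN hL).
have step := lyapunov_decrease h0 hN.
by rewrite exprS -mulrA (le_trans step) // ler_wpM2l.
Qed.

Lemma accuracy_reached y0 h eps k : 0 < h ->
  h * Num.max (E y0) Q `^ rate_exponent s <= step_scale s A ->
  0 < eps -> 0 < E y0 -> ln (mu * E y0 / eps) <= h / 4 * k%:R ->
  f (rsubmx (rk_iter a b F h y0 k)) - f xs <= eps.
Proof.
move=> h0 hL e0 E0 hk; have [H _ _ _] := lyapunov_bounds (rk_iter a b F h y0 k).
have /andP[r0 _] := step_lt4 h0 hL.
have m0 : 0 < mu * E y0 / eps by rewrite divr_gt0 // mulr_gt0.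
have D1 : (1 - h / 4) ^+ k <= eps / (mu * E y0).
  apply: (@le_trans _ _ (expR (- (h / 4)) ^+ k)).
    by rewrite lerXn2r ?nnegrE ?expR_ge0 // expR_ge1Dx.
  rewrite -expRM_natr mulNr -[eps / _]invf_div -[(_ / eps)]lnK ?posrE // -expRN.
  by rewrite ler_expR lerN2.
have D2 := ler_wpM2r (ltW E0) D1.
have D3 : eps / (mu * E y0) * E y0 = eps / mu by field; rewrite !gt_eqF.
apply: (le_trans H); rewrite D3 in D2.
have := le_trans (lyapunov_iterates h0 hL k) D2.
rewrite ler_pdivlMr // mulrC => D4; rewrite ler_pdivrMr // (le_trans D4) //.
by rewrite ler_peMr ?ler1n // ltW.
Qed.

End iterates.

End accelerated_flow_theory.

(** * Convergence of the discretised flow *)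

Theorem theorem4 (R : realType) (s S : nat) (a : 'M[R]_S) (b : 'rV[R]_S)
    (s_ge1 : (1 <= s)%N) (rk_order : rk_has_order a b s) :
  exists c K : R, 0 < c /\ 0 < K /\
    forall (d : nat) (mu L : R) (f : 'rV[R]_d -> R) (xs : 'rV[R]_d),
      (1 <= d)%N -> 0 < mu -> 0 < L ->
      unique_minimizer f xs ->
      quasi_strongly_convex mu f xs ->
      times_differentiable s.+1 f ->
      (forall (n : nat) (x : 'rV[R]_d), (2 <= n <= s.+1)%N ->
         (tensor_norm (nabla n f x) <= L%:E)%E) ->
      forall y0 : 'rV[R]_(d + d),
        let Q := L / mu in
        let gamma := rate_exponent s in
        let E := lyapunov mu Q f xs in
        let y := rk_iter a b (vfield mu Q f) in
        (forall h : R, 0 < h -> h <= step_bound s c (E y0) Q ->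
           forall N : nat, E (y h y0 N) <= (1 - h / 4) ^+ N * E y0)
        /\
        (forall eps : R, 0 < eps -> eps <= mu * E y0 / 2 ->
           let h := step_bound s c (E y0) Q in
           exists N : nat,
             (S * N)%:R <=
               K * (S%:R * Num.max (E y0) Q `^ gamma * ln (mu * E y0 / eps))
             /\ forall k : nat, (N <= k)%N -> f (rsubmx (y h y0 k)) - f xs <= eps).
Proof.
have [C C0 LE] := uniform_local_error rk_order.
pose A := (1 + C) ^+ 2; have A1 : 1 <= A by rewrite exprn_ege1 // lerDl.
have A0 : 0 < A by apply: lt_le_trans A1.
set kappa := step_scale s A.
have k0 : 0 < kappa := step_scale_gt0 s A0.
have ln2 : 0 < ln 2 :> R by rewrite ln_gt0 // ltr1n.
(* The first witness makes the numerical factor of the step bound equal to kappa. In the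
   second, 4 / kappa counts the 4 / h iterations per unit of the logarithm, and 4 / ln 2
   pays for rounding up, the logarithm being at least ln 2. *)
exists ((2 * kappa)^-1 ^+ s.+1), (4 / kappa + 4 / ln 2); split.
  by rewrite exprn_gt0 // invr_gt0 mulr_gt0.
split; first by rewrite addr_gt0 // divr_gt0.
move=> d mu L f xs d1 mu0 L0 [xmin _] qsc fs fL y0 Q gamma E y.
have QE : L = mu * Q by rewrite /Q mulrCA divff ?mulr1 // gt_eqF.
have Q0 : 0 < Q by apply: divr_gt0.
have Q4 : 1 / 4 <= Q := condition_ge s_ge1 d1 mu0 L0 xmin qsc fs fL QE.
have [_ _ _ E0] := lyapunov_bounds mu0 L0 xmin QE y0.
have L4 : 1 / 4 <= Num.max (E y0) Q by rewrite le_max Q4 orbT.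
have Lp : 0 < Num.max (E y0) Q by rewrite lt_max Q0 orbT.
have g0 : 0 < Num.max (E y0) Q `^ gamma by apply: powR_gt0.
rewrite (step_boundE s A0 E0 Q0); split=> [h h0 hb N|eps e0 eE h].
  apply: (lyapunov_iterates s_ge1 d1 mu0 L0 xmin qsc fs fL QE C0 LE h0).
  by rewrite -ler_pdivlMr.
have Ep : 0 < E y0.
  have : 0 < mu * E y0 by rewrite (lt_le_trans _ (le_trans eE _)) // ler_pdivrMr // ler_peMr ?ler1n // mulr_ge0 // ltW.
  by rewrite pmulr_rgt0.
have h0 : 0 < h by rewrite divr_gt0.
have hL : h * Num.max (E y0) Q `^ gamma <= kappa.
  by rewrite /h divfK // gt_eqF.
set l := ln (mu * E y0 / eps); set g := Num.max (E y0) Q `^ gamma in g0 hL *.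
have l2 : ln 2 <= l.
  have m2 : 2 <= mu * E y0 / eps.
    by rewrite ler_pdivlMr // [leLHS]mulrC -ler_pdivlMr.
  have mp : 0 < mu * E y0 / eps by apply: lt_le_trans m2.
  by rewrite /l ler_ln ?posrE.
have l0 : 0 < l by apply: lt_le_trans l2.
have ig : g^-1 <= 4.
  rewrite -powRN; apply: powRN_le4 => //.
  by rewrite gamma_ge0 gamma_le1.
have t0 : 0 <= 4 / h * l by rewrite !mulr_ge0 ?invr_ge0 // ltW.
have /andP[N1 N2] := truncn_itv t0.
exists (Num.truncn (4 / h * l)).+1; split=> [|k Nk].
  have -> : (4 / kappa + 4 / ln 2) * (S%:R * g * l) =
      S%:R * ((4 / kappa + 4 / ln 2) * (g * l)) by ring.
  rewrite natrM ler_wpM2l //.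
  have hE : 4 / h * l = 4 / kappa * (g * l).
    have -> : h = kappa / g by [].
    by field; rewrite !gt_eqF.
  have lln : 1 <= l / ln 2 by rewrite ler_pdivlMr // mul1r.
  have g4 : 1 <= 4 * g by rewrite -ler_pdivrMr // div1r.
  have one : 1 <= 4 / ln 2 * (g * l).
    have -> : 4 / ln 2 * (g * l) = 4 * g * (l / ln 2) by ring.
    exact: mulr_ege1.
  apply: (@le_trans _ _ (4 / h * l + 1)); first by rewrite -natr1 lerD2r.
  by rewrite hE [leRHS]mulrDl lerD2l.
apply: (accuracy_reached s_ge1 d1 mu0 L0 xmin qsc fs fL QE C0 LE h0 hL e0 Ep).
have kN : 4 / h * l <= k%:R.
  by rewrite (le_trans (ltW N2)) // ler_nat.
have := ler_wpM2l (ltW (divr_gt0 h0 (ltr0n R 4))) kN.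
by rewrite (_ : h / 4 * (4 / h * l) = l) //; field; rewrite gt_eqF.
Qed.
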